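(* Assume that $F\in L^2(\Omega;\mathbb R^3)$, $f\in L^2(\Gamma_N;\mathbb R^3)$, $\|F\|_{L^2(\Omega;\mathbb R^3)}+\|f\|_{L^2(\Gamma_N;\mathbb R^3)}>0$ and $\zeta_{lim}>0$. Let $\alpha>0$ and suppose that there exists a solution $u$ to problem $(\mathcal P)^\alpha$, i.e. $u\in\mathbb V^\alpha$ with $\Psi(\varepsilon(u))\le\Psi(\varepsilon(v))$ for all $v\in\mathbb V^\alpha$. Then, with $\zeta:=\psi(\alpha)$, $$\zeta=\psi(\alpha)=\frac1\alpha\langle\Sigma(\varepsilon(u)),\varepsilon(u)\rangle .$$ In addition, $u$ is a solution to $(\mathcal P)_\zeta$, i.e. $u$ minimizes $J_\zeta$ over $\mathbb V$, and $\sigma=\Sigma(\varepsilon(u))$ is the solution to both problems $(\mathcal P^* )^\alpha$ and $(\mathcal P^* )_\zeta$. Conversely, if $\zeta\in\mathbb R_+$ and $u\in\mathbb V$ is a solution to $(\mathcal P)_\zeta$, then $u$ also solves $(\mathcal P)^\alpha$ for $\alpha=L(u)$.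
   Context: $\mathbb R_+=[0,+\infty)$. $\Omega\subset\mathbb R^3$ is a bounded domain with Lipschitz boundary $\partial\Omega=\overline{\Gamma}_D\cup\overline{\Gamma}_N$, where $\Gamma_D,\Gamma_N$ are relatively open, disjoint, and $\Gamma_D$ has positive surface measure. $\mathbb R^{3\times3}_{sym}$ is the space of symmetric $3\times3$ matrices with scalar product $\eta:\xi=\eta_{ij}\xi_{ij}$. $C:\mathbb R^{3\times3}_{sym}\to\mathbb R^{3\times3}_{sym}$ is a linear map (independent of $x$), symmetric ($C\eta:\xi=\eta:C\xi$) and positive definite ($C\eta:\eta\ge\delta\,\eta:\eta$ for some $\delta>0$). $S=L^2(\Omega;\mathbb R^{3\times3}_{sym})$ with $\langle\tau,e\rangle=\int_\Omega\tau:e\,dx$, and $\|\tau\|_{C^{-1}}=\langle C^{-1}\tau,\tau\rangle^{1/2}$. $\mathbb V=\{v\in H^1(\Omega;\mathbb R^3): v=0\text{ on }\Gamma_D\}$, $\varepsilon(v)=\frac12(\nabla v+(\nabla v)^T)$, $L(v)=\int_\Omega F\cdot v\,dx+\int_{\Gamma_N}f\cdot v\,ds$. $\Phi:\mathbb R^{3\times3}_{sym}\to\mathbb R$ is a continuous convex function with $\Phi(0)=0$, and $\gamma>0$ is a constant. $P=\{\tau\in S:\Phi(\tau(x))\le\gamma\text{ for a.a. }x\in\Omega\}$. For $\zeta\in\mathbb R_+$, $\Lambda_{\zeta L}=\{\tau\in S:\langle\tau,\varepsilon(v)\rangle=\zeta L(v)\ \forall v\in\mathbb V\}$. $\mathcal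 I(\tau)=\frac12\|\tau\|_{C^{-1}}^2$. $\mathcal D=\{\zeta\in\mathbb R_+:\Lambda_{\zeta L}\cap P\neq\emptyset\}$ and $\zeta_{lim}=\sup\mathcal D\in[0,+\infty]$. Problem $(\mathcal P^* )_\zeta$: find the minimizer $\sigma(\zeta)$ of $\mathcal I$ over $\Lambda_{\zeta L}\cap P$; it has a unique solution for $\zeta\in\mathcal D$. The function $\phi:\mathbb R\to\overline{\mathbb R}$ is $\phi(\zeta)=\mathcal I(\sigma(\zeta))$ for $\zeta\in\mathcal D$, $\phi(\zeta)=+\infty$ otherwise. For $\alpha\in\mathbb R_+$, $\psi(\alpha)\in\mathcal D$ is the unique minimizer over $\mathcal D$ of $\tilde\zeta\mapsto\phi(\tilde\zeta)-\alpha\tilde\zeta$. $\Pi:S\to P$ is the projection onto $P$ with respect to the scalar product $(\sigma,\tau)\mapsto\langle C^{-1}\sigma,\tau\rangle$, $\Sigma(e)=\Pi(Ce)$ for $e\in S$, and $\Psi(e)=\sup_{\tau\in P}\{\langle\tau,e\rangle-\frac12\|\tau\|_{C^{-1}}^2\}=\langle\Sigma(e),e\rangle-\frac12\|\Sigma(e)\|_{C^{-1}}^2$ for $e\in S$. $J_\zeta(v)=\Psi(\varepsilon(v))-\zeta L(v)$, $v\in\mathbb V$. Problem $(\mathcal P)_\zeta$: find $u\in\mathbb V$ with $J_\zeta(u)\le J_\zeta(v)$ for all $v\in\mathbb V$. $\mathbb V^\alpha=\{v\in\mathbb V: L(v)=\alpha\}$, and problem $(\mathcal P)^\alpha$: find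 $u\in\mathbb V^\alpha$ with $\Psi(\varepsilon(u))\le\Psi(\varepsilon(v))$ for all $v\in\mathbb V^\alpha$. $\tilde\Lambda_L=\bigcup_{\tilde\zeta\in\mathbb R_+}\Lambda_{\tilde\zeta L}$; for $\tau\in\tilde\Lambda_L$, $\omega(\tau)$ denotes the unique $\tilde\zeta\in\mathbb R_+$ with $\tau\in\Lambda_{\tilde\zeta L}$. Problem $(\mathcal P^* )^\alpha$, $\alpha\ge0$: find $\sigma\in\tilde\Lambda_L\cap P$ with $\mathcal I(\sigma)-\alpha\omega(\sigma)\le\mathcal I(\tau)-\alpha\omega(\tau)$ for all $\tau\in\tilde\Lambda_L\cap P$; it has a unique solution. *)

(* Defs.v *)
From HB Require Import structures.
From mathcomp Require Import all_boot all_order all_algebra.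
From mathcomp Require Import all_classical all_reals all_analysis.

Set Implicit Arguments.
Unset Strict Implicit.
Unset Printing Implicit Defensive.
Import Order.TTheory GRing.Theory Num.Theory.
Import numFieldNormedType.Exports.

Local Open Scope classical_set_scope.
Local Open Scope ring_scope.

(* Points of R^3 are row vectors. MathComp-Analysis puts no sigma-algebra on
   matrices, so row vectors receive the product (that is, Borel) one. *)
Definition rv_display : measure_display -> measure_display.
Proof. exact. Qed.

Section rv_measurable.
Context (R : realType) (n : nat).

Definition rv_coord (i : 'I_n) (x : 'rV[R]_n) : measurableTypeR R := x ord0 i.

Let rv_set0 : g_sigma_preimage rv_coord set0.
Proof. exact: sigma_algebra0. Qed.

Let rv_setC A : g_sigma_preimage rv_coord A -> g_sigma_preimage rv_coord (~` A).
Proof. exact: sigma_algebraC. Qed.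

Let rv_bigcup (F : _^nat) : (forall i, g_sigma_preimage rv_coord (F i)) ->
  g_sigma_preimage rv_coord (\bigcup_i (F i)).
Proof. exact: sigma_algebra_bigcup. Qed.

HB.instance Definition _ := @isMeasurable.Build
  (rv_display default_measure_display)
  'rV[R]_n (g_sigma_preimage rv_coord) rv_set0 rv_setC rv_bigcup.

End rv_measurable.

Section lebesgue3.
Context (R : realType).
Local Notation mR := (measurableTypeR R).

Definition rv3 (p : mR * mR * mR) : 'rV[R]_3 :=
  \row_(i < 3) [:: p.1.1; p.1.2; p.2]`_i.

Lemma measurable_rv3 : measurable_fun setT rv3.
Proof.
apply: (@measurability _ _ _ _ _ _
  (\big[setU/set0]_(i < 3) preimage_set_system setT (@rv_coord R 3 i) measurable)).
  by [].
rewrite !big_ord_recr big_ord0 /= set0U => _ [A [[[B mB <-]|[B mB <-]]|[B mB <-]] <-].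
all: rewrite !setTI -comp_preimage.
- rewrite (_ : _ \o _ = fst \o fst); last first.
    by apply/funext => p; rewrite /rv_coord /= mxE.
  rewrite -[X in measurable X]setTI.
  exact: (measurableT_comp measurable_fst measurable_fst).
- rewrite (_ : _ \o _ = snd \o fst); last first.
    by apply/funext => p; rewrite /rv_coord /= mxE.
  rewrite -[X in measurable X]setTI.
  exact: (measurableT_comp measurable_snd measurable_fst).
- rewrite (_ : _ \o _ = snd); last first.
    by apply/funext => p; rewrite /rv_coord /= mxE.
  by rewrite -[X in measurable X]setTI; exact: measurable_snd.
Qed.

Definition lebesgue3 : set 'rV[R]_3 -> \bar R :=
  pushforward ((@lebesgue_measure R \x @lebesgue_measure R) \x
    @lebesgue_measure R)%E rv3.

Let lebesgue3_set0 : lebesgue3 set0 = 0%E.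
Proof. by rewrite /lebesgue3 /pushforward preimage_set0 measure0. Qed.

Let lebesgue3_ge0 A : (0 <= lebesgue3 A)%E.
Proof. by rewrite /lebesgue3 /pushforward. Qed.

Let lebesgue3_sigma_additive : semi_sigma_additive lebesgue3.
Proof.
move=> A mA tA mUA; rewrite /lebesgue3 /pushforward preimage_bigcup.
have mpre B : measurable B -> measurable (rv3 @^-1` B).
  by move=> mB; rewrite -[X in measurable X]setTI; exact: measurable_rv3.
apply: measure_semi_sigma_additive.
- by move=> n; exact: mpre.
- apply/trivIsetP => i j _ _ ij; rewrite -preimage_setI.
  by move/trivIsetP : tA => /(_ _ _ _ _ ij) ->//; rewrite preimage_set0.
- by rewrite -preimage_bigcup; exact: mpre.
Qed.

HB.instance Definition _ := isMeasure.Build _ _ _ lebesgue3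
  lebesgue3_set0 lebesgue3_ge0 lebesgue3_sigma_additive.

End lebesgue3.

Section hausdorff2.
Context (R : realType).
Local Open Scope ereal_scope.

Definition enorm (x : 'rV[R]_3) : R := Num.sqrt (\sum_i x ord0 i ^+ 2)%R.

(* Adding 0 only matters for the empty set. *)
Definition ediam (A : set 'rV[R]_3) : \bar R :=
  ereal_sup ([set 0] `|` [set (enorm (p.1 - p.2)%R)%:E | p in A `*` A]).

Definition hgauge (d : R) (A : set 'rV[R]_3) : \bar R :=
  if ediam A <= d%:E then (pi / 4)%:E * (ediam A * ediam A) else +oo.

(* Two-dimensional Hausdorff measure, normalized so that it is the surface
   area on surfaces. The infimum in mu_ext is over coverings by Borel sets; as
   closures have the same diameter, arbitrary coverings give the same value. *)
Definition hausdorff2 (A : set 'rV[R]_3) : \bar R :=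
  ereal_sup [set mu_ext (hgauge d) A | d in [set d | (0 < d)%R]].

Lemma ediam_ge0 A : 0 <= ediam A.
Proof. by apply: ereal_sup_ubound; left. Qed.

Lemma ediam0 : ediam set0 = 0.
Proof.
rewrite /ediam (_ : _ `|` _ = [set 0]) ?ereal_sup1//.
by apply/seteqP; split=> [x [//|[p [[]]]]|x ->]; last left.
Qed.

Lemma hgauge_ge0 d A : 0 <= hgauge d A.
Proof.
rewrite /hgauge; case: ifP => // _.
by rewrite !mule_ge0 ?ediam_ge0// lee_fin divr_ge0// pi_ge0.
Qed.

Lemma hgauge0 d : (0 < d)%R -> hgauge d set0 = 0.
Proof. by move=> d0; rewrite /hgauge ediam0 lee_fin ltW// !mule0. Qed.

Let hausdorff2_set0 : hausdorff2 set0 = 0.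
Proof.
rewrite /hausdorff2 (_ : [set _ | _ in _] = [set 0]) ?ereal_sup1//.
apply/seteqP; split=> [_ [d d0 <-]|_ ->].
  by rewrite /= mu_ext0 ?hgauge0//; exact: hgauge_ge0.
by exists 1%R => //=; rewrite mu_ext0 ?hgauge0//; exact: hgauge_ge0.
Qed.

Let hausdorff2_ge0 A : 0 <= hausdorff2 A.
Proof.
apply: (@le_trans _ _ (mu_ext (hgauge 1) A)).
  by apply: mu_ext_ge0; exact: hgauge_ge0.
by apply: ereal_sup_ubound; exists 1%R => //=.
Qed.

Let le_hausdorff2 : {homo hausdorff2 : A B / A `<=` B >-> A <= B}.
Proof.
move=> A B AB; apply: ge_ereal_sup => _ [d d0 <-].
apply: (le_trans (le_mu_ext _ AB)).
by apply: ereal_sup_ubound; exists d.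
Qed.

Let hausdorff2_subadd : sigma_subadditive hausdorff2.
Proof.
move=> F; apply: ge_ereal_sup => _ [d d0 <-].
apply: (le_trans (mu_ext_sigma_subadditive (@hgauge_ge0 d) F)).
apply: lee_nneseries => [i _|i _]; first by move=> *; exact: (mu_ext_ge0 (@hgauge_ge0 d)).
by apply: ereal_sup_ubound; exists d.
Qed.

HB.instance Definition _ := isOuterMeasure.Build R 'rV[R]_3 hausdorff2
  hausdorff2_set0 hausdorff2_ge0 le_hausdorff2 hausdorff2_subadd.

Definition hausdorff2_outer : {outer_measure set 'rV[R]_3 -> \bar R} :=
  hausdorff2.

(* R^3 with the Caratheodory-measurable sets of the Hausdorff measure. *)
Definition surfT : measurableType (caratheodory_display hausdorff2_outer) :=
  caratheodory_type hausdorff2_outer.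

Definition surf : {measure set surfT -> \bar R} :=
  (hausdorff2_outer : set (caratheodory_type hausdorff2_outer) -> \bar R).

End hausdorff2.
Arguments lebesgue3 {R}.
Arguments surf {R}.

Section L2.
Context d (T : measurableType d) (R : realType) (mu : {measure set T -> \bar R}).
Context (m n : nat).
Implicit Types (D : set T) (f g : T -> 'M[R]_(m, n)).

(* Square-integrable fields on D, as everywhere-defined representatives whose
   values off D are irrelevant. Measurability is that of the extension by 0,
   because measurable_fun D is void when D is not known to be measurable. *)
Definition L2 D f := forall i j,
  measurable_fun setT ((fun x => f x i j) \_ D) /\
  (\int[mu]_(x in D) ((f x i j) ^+ 2)%:E < +oo)%E.

Definition ddot (A B : 'M[R]_(m, n)) : R := \sum_i \sum_j A i j * B i j.

Definition l2dot D f g : R := \int[mu]_(x in D) ddot (f x) (g x).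

Definition l2norm D f : R := Num.sqrt (l2dot D f f).

End L2.

Section geometry.
Context (R : realType).
Implicit Types (Omega G : set 'rV[R]_3).

Definition bdry Omega := closure Omega `\` interior Omega.

(* Near each boundary point, in some orthonormal coordinate system centred
   there, Omega is the region above the graph of a Lipschitz function. *)
Definition lipschitz_boundary Omega :=
  forall x, bdry Omega x ->
  exists (Q : 'M[R]_3) (g : 'rV[R]_2 -> R) (r : R),
    [/\ Q *m Q^T = 1%:M, lipschitz g, 0 < r &
        forall y, enorm (y - x) < r ->
          let z := (y - x) *m Q in
          Omega y <-> g (col' ord_max z) < z ord0 ord_max].

Definition bounded_lipschitz_domain Omega :=
  [/\ open Omega, connected Omega, Omega !=set0, bounded_set Omega &
      lipschitz_boundary Omega].

Definition rel_open_in G B := exists2 U, open U & G = B `&` U.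

Definition boundary_parts Omega GD GN :=
  [/\ rel_open_in GD (bdry Omega), rel_open_in GN (bdry Omega),
      GD `&` GN = set0, bdry Omega = closure GD `|` closure GN &
      (0 < surf GD)%E].

End geometry.

Section sobolev.
Context (R : realType).
Implicit Types (Omega : set 'rV[R]_3).

Definition pderiv (j : 'I_3) (phi : 'rV[R]_3 -> R) : 'rV[R]_3 -> R :=
  fun x => 'D_(delta_mx ord0 j) phi x.

Definition smooth (phi : 'rV[R]_3 -> R) :=
  forall (s : seq 'I_3) x, differentiable (foldr pderiv phi s) x.

Definition test_function Omega (phi : 'rV[R]_3 -> R) :=
  let supp := closure [set x | phi x != 0] in
  [/\ smooth phi, compact supp & supp `<=` Omega].

Definition weak_gradient Omega (v : 'rV[R]_3 -> 'rV[R]_3)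
    (G : 'rV[R]_3 -> 'M[R]_3) :=
  forall phi, test_function Omega phi -> forall i j,
    \int[lebesgue3]_(x in Omega) (v x ord0 i * pderiv j phi x) =
    - \int[lebesgue3]_(x in Omega) (G x i j * phi x).

(* A function of H^1 is carried together with a representative of its weak
   gradient (which it determines almost everywhere): v.1 is the function and
   v.2 its gradient, (v.2 x) i j being the j-th derivative of component i. *)
Definition field1 : Type :=
  (('rV[R]_3 -> 'rV[R]_3) * ('rV[R]_3 -> 'M[R]_3))%type.

Definition H1 Omega : set field1 := [set v |
  [/\ L2 lebesgue3 Omega v.1, L2 lebesgue3 Omega v.2 &
      weak_gradient Omega v.1 v.2]].

Definition h1norm Omega (v : field1) : R :=
  Num.sqrt (l2norm lebesgue3 Omega v.1 ^+ 2 + l2norm lebesgue3 Omega v.2 ^+ 2).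

Definition lin1 (a : R) (v w : field1) : field1 :=
  (fun x => a *: v.1 x + w.1 x, fun x => a *: v.2 x + w.2 x).

(* The bounded linear map from H^1(Omega) to L^2(bdry Omega) that restricts
   functions continuous up to the boundary. By the trace theorem it exists
   for a bounded Lipschitz domain, and it is unique up to null sets. *)
Definition is_trace Omega (T : field1 -> 'rV[R]_3 -> 'rV[R]_3) :=
  [/\ forall v, H1 Omega v -> L2 surf (bdry Omega) (T v),
      forall a v w, H1 Omega v -> H1 Omega w ->
        (T (lin1 a v w) : surfT R -> 'rV[R]_3) =
        (fun x => a *: T v x + T w x) %[ae surf in bdry Omega],
      exists c : R, forall v, H1 Omega v ->
        l2norm surf (bdry Omega) (T v) <= c * h1norm Omega v &
      forall v, H1 Omega v -> {within closure Omega, continuous v.1} ->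
        (T v : surfT R -> 'rV[R]_3) = v.1 %[ae surf in bdry Omega]].

Definition trace Omega : field1 -> 'rV[R]_3 -> 'rV[R]_3 :=
  xget (fun _ _ => 0) [set T | is_trace Omega T].

Definition sym_grad (v : field1) : 'rV[R]_3 -> 'M[R]_3 :=
  fun x => 2^-1 *: (v.2 x + (v.2 x)^T).

End sobolev.

Section plasticity.
Context (R : realType).
Local Notation E := 'rV[R]_3.
Local Notation stress := (E -> 'M[R]_3).

Definition sym3 : set 'M[R]_3 := [set A | A^T = A].

(* A linear map of symmetric matrices is represented by any of its linear
   extensions to all matrices. *)
Definition elasticity (C : {linear 'M[R]_3 -> 'M[R]_3}) :=
  [/\ forall A, sym3 A -> sym3 (C A),
      forall A B, sym3 A -> sym3 B -> ddot (C A) B = ddot A (C B) &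
      exists2 delta : R, 0 < delta &
        forall A, sym3 A -> delta * ddot A A <= ddot (C A) A].

Context (Omega GD GN : set E) (C : {linear 'M[R]_3 -> 'M[R]_3}).
Context (Phi : 'M[R]_3 -> R) (gamma : R) (F f : E -> E).

(* Inverse of C as a map of symmetric matrices. *)
Definition Cinv : 'M[R]_3 -> 'M[R]_3 := 'pinv_(fun=> 0) sym3 C.

Definition stresses : set stress := [set tau |
  L2 lebesgue3 Omega tau /\ forall x, Omega x -> sym3 (tau x)].

Definition sdot (tau e : stress) : R := l2dot lebesgue3 Omega tau e.

Definition cnorm (tau : stress) : R := Num.sqrt (sdot (Cinv \o tau) tau).

Definition Vspace : set (field1 R) := [set v | H1 Omega v /\
  (trace Omega v : surfT R -> E) = (fun=> 0) %[ae surf in GD]].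

Definition load (v : field1 R) : R :=
  l2dot lebesgue3 Omega F v.1 + l2dot surf GN f (trace Omega v).

Definition plastic : set stress := [set tau | stresses tau /\
  {ae lebesgue3, forall x, Omega x -> Phi (tau x) <= gamma}].

Definition Lambda (zeta : R) : set stress := [set tau | stresses tau /\
  forall v, Vspace v -> sdot tau (sym_grad v) = zeta * load v].

Definition energy (tau : stress) : R := 2^-1 * cnorm tau ^+ 2.

Definition Dset : set R := [set zeta |
  0 <= zeta /\ (Lambda zeta `&` plastic) !=set0].

Definition zeta_lim : \bar R := ereal_sup [set zeta%:E | zeta in Dset].

Definition solves_dual (zeta : R) (sigma : stress) :=
  (Lambda zeta `&` plastic) sigma /\
  forall tau, (Lambda zeta `&` plastic) tau -> energy sigma <= energy tau.

Definition sigma_of (zeta : R) : stress :=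
  xget (fun=> 0) [set sigma | solves_dual zeta sigma].

Definition phi (zeta : R) : \bar R :=
  if zeta \in Dset then (energy (sigma_of zeta))%:E else +oo%E.

Definition psi (alpha : R) : R := xget 0 [set zeta | Dset zeta /\
  forall z, Dset z ->
    (phi zeta - (alpha * zeta)%:E <= phi z - (alpha * z)%:E)%E].

Definition proj (s : stress) : stress := xget (fun=> 0) [set p | plastic p /\
  forall tau, plastic tau ->
    cnorm (fun x => s x - p x) <= cnorm (fun x => s x - tau x)].

Definition Sigma (e : stress) : stress := proj (C \o e).

Definition Psi (e : stress) : R :=
  sup [set sdot tau e - 2^-1 * cnorm tau ^+ 2 | tau in plastic].

Definition Jfun (zeta : R) (v : field1 R) : R :=
  Psi (sym_grad v) - zeta * load v.

Definition solves_primal (zeta : R) (u : field1 R) :=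
  Vspace u /\ forall v, Vspace v -> Jfun zeta u <= Jfun zeta v.

Definition Vspace_alpha (alpha : R) : set (field1 R) :=
  [set v | Vspace v /\ load v = alpha].

Definition solves_primal_alpha (alpha : R) (u : field1 R) :=
  Vspace_alpha alpha u /\
  forall v, Vspace_alpha alpha v -> Psi (sym_grad u) <= Psi (sym_grad v).

Definition Lambda_tilde : set stress :=
  \bigcup_(z in [set z | 0 <= z]) Lambda z.

Definition omega (tau : stress) : R :=
  xget 0 [set z | 0 <= z /\ Lambda z tau].

Definition solves_dual_alpha (alpha : R) (sigma : stress) :=
  (Lambda_tilde `&` plastic) sigma /\
  forall tau, (Lambda_tilde `&` plastic) tau ->
    energy sigma - alpha * omega sigma <= energy tau - alpha * omega tau.

End plasticity.
Arguments sym3 {R}.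

(* Main.v *)
From HB Require Import structures.
Require Import Defs.
From mathcomp Require Import all_boot all_order all_algebra.
From mathcomp Require Import all_classical all_reals all_analysis.
From mathcomp Require Import measurable_realfun.
From mathcomp Require Import ring lra.

(** The functional [Psi] is convex and differentiable with derivative
    [Sigma e] at [e]; both facts follow from the strong concavity of
    [tau |-> <tau, e> - |tau|^2 / 2] on the convex set [P] of plastically
    admissible stresses, of which [Sigma e] is the maximizer. If [u] minimizes
    [Psi (eps v)] subject to [L v = alpha], then the derivative vanishes on the
    kernel of [L], so [sigma = Sigma (eps u)] satisfies
    [<sigma, eps v> = zeta L v] for all [v], where
    [zeta = <sigma, eps u> / alpha]: the Lagrange multiplier is a load factor
    and [sigma] lies in [Lambda_(zeta L)]. Convexity then gives that [u]
    minimizes [J_zeta], and as [<tau, eps u> = alpha omega(tau)] for [tau] in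
    the [Lambda]'s, that [sigma] minimizes [I - alpha omega]. Strong concavity
    makes the minimizer unique, which identifies [zeta] with [psi alpha].

    The projection defining [Sigma], and the solutions of the dual problems
    entering [phi], exist by the projection theorem in [L^2]; the underlying
    completeness is the Riesz-Fischer argument, in which a sequence [g] with
    [|g_(n+1) - g_n|^2 <= c 8^(-n)] converges almost everywhere because
    [sum_n 4^n |g_(n+1) - g_n|^2] is integrable. *)

Set Implicit Arguments.
Unset Strict Implicit.
Unset Printing Implicit Defensive.
Import Order.TTheory GRing.Theory Num.Theory.
Import numFieldNormedType.Exports.
Local Open Scope classical_set_scope.
Local Open Scope ring_scope.

(** * Square-integrable functions *)

Section square_integrable.
Context d (T : measurableType d) (R : realType) (mu : {measure set T -> \bar R}).
Implicit Types g h : T -> R.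

Definition sqint g := measurable_fun setT g /\
  mu.-integrable setT (fun x => ((g x) ^+ 2)%:E).

Lemma sqintP g : sqint g <->
  measurable_fun setT g /\ (\int[mu]_x ((g x) ^+ 2)%:E < +oo)%E.
Proof.
split=> [[mg /integrableP[_ ig]]|[mg ig]]; split => //.
  by move: ig; under eq_integral do rewrite gee0_abs ?lee_fin ?sqr_ge0//.
apply/integrableP; split.
  by apply/measurable_EFinP; apply: measurable_funX.
by under eq_integral do rewrite gee0_abs ?lee_fin ?sqr_ge0//.
Qed.

Lemma le_integrable_fin g h : measurable_fun setT g ->
  (forall x, `|g x| <= h x) ->
  mu.-integrable setT (fun x => (h x)%:E) ->
  mu.-integrable setT (fun x => (g x)%:E).
Proof.
move=> mg gh; apply: le_integrable => //; first exact/measurable_EFinP.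
by move=> x _; rewrite !abse_EFin lee_fin (le_trans (gh x))// ler_norm.
Qed.

Lemma integrable_sqr_lin a b g h : sqint g -> sqint h ->
  mu.-integrable setT (fun x => (a * g x ^+ 2 + b * h x ^+ 2)%:E).
Proof.
move=> [_ ig] [_ ih].
apply: (@eq_integrable _ _ _ _ _ _
  ((fun x => a%:E * ((g x) ^+ 2)%:E) \+ (fun x => b%:E * ((h x) ^+ 2)%:E))%E) => //.
by apply: integrableD => //; exact: integrableZl.
Qed.

Lemma sqint_mul g h : sqint g -> sqint h ->
  mu.-integrable setT (fun x => (g x * h x)%:E).
Proof.
move=> sg sh; have := integrable_sqr_lin 1 1 sg sh.
apply: le_integrable_fin; first by apply: measurable_funM; [case: sg|case: sh].
move=> x; rewrite !mul1r ler_norml; apply/andP; split.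
  by have := sqr_ge0 (g x + h x); nra.
by have := sqr_ge0 (g x - h x); nra.
Qed.

Lemma sqint_lin a g h : sqint g -> sqint h -> sqint (fun x => a * g x + h x).
Proof.
move=> sg sh.
have mf : measurable_fun setT (fun x => a * g x + h x).
  apply: measurable_funD; last by case: sh.
  by apply: measurable_funM => //; case: sg.
split => //.
have := integrable_sqr_lin (2 * a ^+ 2) 2 sg sh.
apply: le_integrable_fin; first exact: measurable_funX.
move=> x; rewrite ger0_norm ?sqr_ge0//.
by have := sqr_ge0 (a * g x - h x); nra.
Qed.

Lemma sqint0 : sqint (fun=> 0).
Proof. by split => //; rewrite expr0n/=; exact: integrable0. Qed.

Lemma Rintegral_sqr_fin g : sqint g ->
  (\int[mu]_x ((g x) ^+ 2)%:E = (\int[mu]_x ((g x) ^+ 2))%:E)%E.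
Proof. by move=> [_ ig]; rewrite fineK//; exact: integrable_fin_num. Qed.

End square_integrable.

(** * Riesz-Fischer theorem for rapidly Cauchy sequences *)

Section fast_cvg.
Context {R : realType}.

(** Each term of the series is at most its sum, so the increments of [u] decay like 2^(-n) and the
    telescoping series is dominated by a geometric one. *)
Lemma cvg_of_summable_sqr (u : R^nat) :
  (\sum_(n <oo) ((4 ^+ n * (u n.+1 - u n) ^+ 2)%:E) < +oo)%E -> cvgn u.
Proof.
pose h n := (4 ^+ n * (u n.+1 - u n) ^+ 2)%:E; move=> hoo.
have h0 n : (0 <= h n)%E by rewrite lee_fin mulr_ge0// ?sqr_ge0// exprn_ge0.
have {}hoo : (\sum_(n <oo) h n < +oo)%E by [].
have hs0 : (0 <= \sum_(n <oo) h n)%E by exact: nneseries_ge0.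
set M := fine (\sum_(n <oo) h n)%E.
have hM n : 4 ^+ n * (u n.+1 - u n) ^+ 2 <= M.
  rewrite -lee_fin fineK ?ge0_fin_numE//.
  apply: le_trans (nneseries_lim_ge n.+1 _); last by [].
  by rewrite big_nat_recr//= leeDr// sume_ge0.
have M0 : 0 <= M by rewrite /M fine_ge0.
(* The constant [M + 1] replaces the square root of [M], since M <= (M + 1)^2. *)
have du n : `|u n.+1 - u n| <= (M + 1) * 2^-1 ^+ n.
  rewrite -(@ler_pXn2r _ 2)// ?nnegrE// ?mulr_ge0// ?addr_ge0//.
  rewrite real_normK ?num_real// exprMn -exprM mulnC exprM.
  have -> : (2^-1 ^+ 2 : R) = 4^-1 by rewrite expr2; lra.
  rewrite exprVn ler_pdivlMr ?exprn_gt0// mulrC.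
  by apply: (le_trans (hM n)); nra.
have cs : cvgn (series (telescope u)).
  apply: normed_cvg.
  apply: (@series_le_cvg _ _ (geometric (M + 1) 2^-1)) => //=.
  - by move=> n; rewrite mulr_ge0// addr_ge0.
  - by apply: is_cvg_geometric_series; rewrite ger0_norm//; lra.
have -> : u = (fun n => u 0%N + series (telescope u) n).
  by apply/funext => n; exact: eq_sum_telescope.
by apply: is_cvgD => //; exact: is_cvg_cst.
Qed.

End fast_cvg.

Section riesz_fischer.
Context d (T : measurableType d) (R : realType) (mu : {measure set T -> \bar R}).
Variables (g : nat -> T -> R) (c : R).
Hypothesis sg : forall n, sqint mu (g n).
Hypothesis gc : forall n m, (n <= m)%N ->
  \int[mu]_x ((g m x - g n x) ^+ 2) <= c * 8^-1 ^+ n.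

Let sB n m : sqint mu (fun x => g m x - g n x).
Proof.
have := sqint_lin (-1) (sg n) (sg m).
by under eq_fun do rewrite mulN1r addrC.
Qed.

Let h n x : \bar R := (4 ^+ n * (g n.+1 x - g n x) ^+ 2)%:E.

Let h0 n x : (0 <= h n x)%E.
Proof. by rewrite lee_fin mulr_ge0// ?sqr_ge0// exprn_ge0. Qed.

Let mh n : measurable_fun setT (h n).
Proof.
apply/measurable_EFinP; apply: measurable_funM => //.
by apply: measurable_funX; case: (sB n n.+1).
Qed.

Let c0 : 0 <= c.
Proof.
have := gc (leqnn 0); rewrite expr0 mulr1; apply: le_trans.
by apply: Rintegral_ge0 => x _; rewrite sqr_ge0.
Qed.

Let int_h : (\int[mu]_x (\sum_(n <oo) h n x) < +oo)%E.
Proof.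
rewrite integral_nneseries//.
(* The bound 4^n c 8^(-n) = c 2^(-n) is written 2c / 2^(n+1), the form summed by
   [epsilon_trick0]. *)
apply: (@le_lt_trans _ _ (\sum_(n <oo) (2 * c / (2 ^ n.+1)%:R)%:E)%E); last first.
  apply: (@le_lt_trans _ _ (2 * c)%:E); last by rewrite ltry.
  by apply: (epsilon_trick0 xpredT); rewrite mulr_ge0.
apply: lee_nneseries => [i _ _|n _]; first exact: integral_ge0.
rewrite /h; under eq_integral do rewrite EFinM.
rewrite integralZl//; last by case: (sB n n.+1).
rewrite Rintegral_sqr_fin// -EFinM lee_fin.
apply: (@le_trans _ _ (4 ^+ n * (c * 8^-1 ^+ n))).
  by rewrite ler_wpM2l ?exprn_ge0// gc.
rewrite mulrCA -exprMn.
have -> : (4 * 8^-1 : R) = 2^-1 by lra.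
by rewrite expnS natrM invfM mulrACA divff// mul1r exprVn natrX.
Qed.

Let cvg_g : {ae mu, forall x, cvgn (g ^~ x)}.
Proof.
have mS : measurable_fun setT (fun x => \sum_(n <oo) h n x)%E.
  apply: (eq_measurable_fun (fun x => \sum_(i <oo | i \in xpredT) h i x)%E).
    by move=> x _; exact: eq_eseriesl.
  exact: ge0_emeasurable_sum.
have iS : mu.-integrable setT (fun x => \sum_(n <oo) h n x)%E.
  apply/integrableP; split => //.
  by under eq_integral do rewrite gee0_abs ?nneseries_ge0//.
have := integrable_ae measurableT iS.
apply: filterS => x /= /(_ I) fx.
apply: cvg_of_summable_sqr; rewrite -ge0_fin_numE; first exact: fx.
by apply: nneseries_ge0 => n _ _; exact: h0.
Qed.

(** An upper limit is defined at every point and is measurable; it is the limit wherever the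
    sequence converges. *)
Definition sqint_lim x := fine (limn_esup (fun n => (g n x)%:E)).

Lemma measurable_sqint_lim : measurable_fun setT sqint_lim.
Proof.
apply: (@measurableT_comp _ _ _ _ _ _ fine) => //.
apply: measurable_fun_limn_esup => n; apply/measurable_EFinP.
by case: (sg n).
Qed.

Lemma sqint_lim_cvg : {ae mu, forall x, g ^~ x @ \oo --> sqint_lim x}.
Proof.
apply: filterS cvg_g => x /cvg_ex[l gl].
rewrite /sqint_lim (_ : limn_esup _ = l%:E)//.
by apply: (cvg_limn_einf_sup _).2; apply: cvg_EFin => //; exact: nearW.
Qed.

(** Fatou's lemma for the functions (g_m - g_n)^2 as m grows: their lower limit [L] is almost
    everywhere the integrand, and their integrals obey the bound as soon as m >= n. *)
Let int_lim n : (\int[mu]_x ((sqint_lim x - g n x) ^+ 2)%:E <=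
  (c * 8^-1 ^+ n)%:E)%E.
Proof.
have mgB m : measurable_fun setT (fun x => ((g m x - g n x) ^+ 2)%:E).
  by apply/measurable_EFinP; apply: measurable_funX; case: (sB n m).
pose L x := limn_einf (fun m => ((g m x - g n x) ^+ 2)%:E).
have mL : measurable_fun setT L.
  rewrite /L /limn_einf.
  apply: (@measurableT_comp _ _ _ _ _ _ (@oppe R)) => //.
  apply: measurable_fun_limn_esup => m.
  exact: measurableT_comp.
have L0 x : (0 <= L x)%E.
  rewrite /L limn_einf_lim; apply: lime_ge; first exact: is_cvg_einfs.
  apply: nearW => k; apply: le_ereal_inf_tmp => _ [m _ <-].
  by rewrite lee_fin sqr_ge0.
rewrite (@ge0_ae_eq_integral _ _ _ _ _ _ L) //=.
- apply: (le_trans (fatou _ _ _ _)) => //=.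
    by move=> m x _; rewrite lee_fin sqr_ge0.
  apply: (le_trans (limn_einf_sup _)); rewrite limn_esup_lim.
  apply: lime_le; first exact: is_cvg_esups.
  exists n => // k /= nk; apply: ge_ereal_sup => _ [m /= km <-].
  by rewrite Rintegral_sqr_fin// lee_fin gc// (leq_trans nk).
- apply/measurable_EFinP; apply: measurable_funX; apply: measurable_funB.
    exact: measurable_sqint_lim.
  by case: (sg n).
- by move=> x _; rewrite lee_fin sqr_ge0.
- apply: filterS sqint_lim_cvg => x gx _.
  apply/esym; apply: (cvg_limn_einf_sup _).1; apply: cvg_EFin; first exact: nearW.
  rewrite (_ : _ \o _ = (fun m => (g m x - g n x) ^+ 2))//.
  by rewrite expr2; apply: cvgM; apply: cvgB => //; exact: cvg_cst.
Qed.

Lemma sqint_sqint_lim : sqint mu sqint_lim.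
Proof.
have s : sqint mu (fun x => sqint_lim x - g 0 x).
  apply/sqintP; split.
    by apply: measurable_funB; [exact: measurable_sqint_lim|case: (sg 0)].
  by apply: (le_lt_trans (int_lim 0)); rewrite ltry.
have := sqint_lin 1 s (sg 0).
by under eq_fun do rewrite mul1r subrK.
Qed.

Lemma sqint_lim_dist n :
  \int[mu]_x ((sqint_lim x - g n x) ^+ 2) <= c * 8^-1 ^+ n.
Proof.
rewrite -lee_fin -Rintegral_sqr_fin//.
have := sqint_lin (-1) (sg n) sqint_sqint_lim.
by under eq_fun do rewrite mulN1r addrC.
Qed.

End riesz_fischer.

(** * Square-integrable matrix fields *)

Section Rintegral_sums.
Context d (T : measurableType d) (R : realType) (mu : {measure set T -> \bar R}).

Lemma Rintegral_sumT (I : Type) (r : seq I) (F : I -> T -> R) :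
  (forall i, mu.-integrable setT (fun x => (F i x)%:E)) ->
  mu.-integrable setT (fun x => (\sum_(i <- r) F i x)%:E) /\
  \int[mu]_x (\sum_(i <- r) F i x) = \sum_(i <- r) \int[mu]_x (F i x).
Proof.
move=> iF; elim: r => [|i r [ir IH]].
  under eq_fun do rewrite big_nil; split; first exact: integrable0.
  by rewrite big_nil; under eq_Rintegral do rewrite big_nil; rewrite Rintegral_cst// mul0r.
split.
  under eq_fun do rewrite big_cons EFinD.
  exact: integrableD.
rewrite big_cons -IH -RintegralD//; last exact: iF.
by apply: eq_Rintegral => x _; rewrite big_cons.
Qed.

Lemma Rintegral_sqint_linl a (g h k : T -> R) :
  sqint mu g -> sqint mu h -> sqint mu k ->
  \int[mu]_x ((a * g x + h x) * k x) =
  a * \int[mu]_x (g x * k x) + \int[mu]_x (h x * k x).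
Proof.
move=> sg sh sk; under eq_Rintegral do rewrite mulrDl -mulrA.
have igk := sqint_mul sg sk.
rewrite RintegralD//; first by rewrite RintegralZl.
  exact: (integrableZl measurableT a igk).
exact: sqint_mul.
Qed.

End Rintegral_sums.

Section L2_fields.
Context d (T : measurableType d) (R : realType) (mu : {measure set T -> \bar R}).
Context (m n : nat).
Implicit Types (D E : set T) (f g h : T -> 'M[R]_(m, n)).

(** Extension by zero turns integrals over [D] into integrals over the whole space and matches the
    measurability condition in [L2]. *)
Definition entry D f i j : T -> R := (fun x => f x i j) \_ D.

Lemma entryE D f i j x : entry D f i j x = if x \in D then f x i j else 0.
Proof. by []. Qed.

Lemma L2P D f : L2 mu D f <-> forall i j, sqint mu (entry D f i j).
Proof.
have E i j : (\int[mu]_(x in D) ((f x i j) ^+ 2)%:E =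
    \int[mu]_x ((entry D f i j x) ^+ 2)%:E)%E.
  rewrite integral_mkcond; apply: eq_integral => x _.
  by rewrite entryE patchE; case: ifP => // _; rewrite expr0n.
by split=> H i j; have := H i j; rewrite E => /sqintP.
Qed.

Lemma entry_lin D a f g i j x : entry D (fun x => a *: f x + g x) i j x =
  a * entry D f i j x + entry D g i j x.
Proof. by rewrite !entryE; case: ifP => _; rewrite ?mxE// mulr0 addr0. Qed.

Lemma L2_lin D a f g : L2 mu D f -> L2 mu D g ->
  L2 mu D (fun x => a *: f x + g x).
Proof.
move=> /L2P Lf /L2P Lg; apply/L2P => i j.
rewrite (_ : entry _ _ _ _ = fun x => a * entry D f i j x + entry D g i j x).
  exact: sqint_lin.
by apply/funext => x; rewrite entry_lin.
Qed.

Lemma L2_0 D : L2 mu D (fun=> 0 : 'M[R]_(m, n)).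
Proof.
apply/L2P => i j; rewrite (_ : entry _ _ _ _ = fun=> 0); first exact: sqint0.
by apply/funext => x; rewrite entryE mxE if_same.
Qed.

(** The extension of [f] vanishes off [D], so [g] may be extended from a larger set. This serves the
    boundary load, where the traction lives on [GN] and the trace on the whole boundary. *)
Lemma l2dotE D E f g : D `<=` E -> L2 mu D f -> L2 mu E g ->
  l2dot mu D f g =
  \sum_i \sum_j \int[mu]_x (entry D f i j x * entry E g i j x).
Proof.
move=> DE /L2P Lf /L2P Lg; rewrite /l2dot Rintegral_mkcond.
have iij i j := sqint_mul (Lf i j) (Lg i j).
transitivity (\int[mu]_x (\sum_i \sum_j entry D f i j x * entry E g i j x)).
  apply: eq_Rintegral => x _; rewrite patchE /ddot.
  case: (boolP (x \in D)) => xD.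
    have xE : x \in E by apply/mem_set/DE/set_mem.
    by apply: eq_bigr => i _; apply: eq_bigr => j _; rewrite !entryE xD xE.
  rewrite big1// => i _; rewrite big1// => j _.
  by rewrite entryE (negbTE xD) mul0r.
rewrite (Rintegral_sumT _ _).2.
  by apply: eq_bigr => i _; rewrite (Rintegral_sumT _ _).2.
by move=> i; exact: (Rintegral_sumT _ _).1.
Qed.

Lemma l2dotC D f g : l2dot mu D f g = l2dot mu D g f.
Proof.
apply: eq_Rintegral => x _; apply: eq_bigr => i _; apply: eq_bigr => j _.
by rewrite mulrC.
Qed.

Lemma eq_l2dot D f f' g g' : {in D, f =1 f'} -> {in D, g =1 g'} ->
  l2dot mu D f g = l2dot mu D f' g'.
Proof. by move=> ff gg; apply: eq_Rintegral => x xD; rewrite ff ?gg. Qed.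

Lemma l2dot_linr D E a f g h : D `<=` E ->
  L2 mu D f -> L2 mu E g -> L2 mu E h ->
  l2dot mu D f (fun x => a *: g x + h x) = a * l2dot mu D f g + l2dot mu D f h.
Proof.
move=> DE Lf Lg Lh; rewrite !(l2dotE DE)//; last exact: L2_lin.
rewrite mulr_sumr -big_split/=; apply: eq_bigr => i _.
rewrite mulr_sumr -big_split/=; apply: eq_bigr => j _.
under eq_Rintegral do rewrite entry_lin mulrC.
move/L2P : Lf => Lf; move/L2P : Lg => Lg; move/L2P : Lh => Lh.
rewrite Rintegral_sqint_linl//.
by congr (_ * _ + _); apply: eq_Rintegral => x _; rewrite mulrC.
Qed.

Lemma l2dot_linl D a f g h :
  L2 mu D f -> L2 mu D g -> L2 mu D h ->
  l2dot mu D (fun x => a *: f x + g x) h = a * l2dot mu D f h + l2dot mu D g h.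
Proof.
by move=> Lf Lg Lh; rewrite l2dotC (l2dot_linr _ (@subset_refl _ D))// !(l2dotC _ h).
Qed.

Lemma ae_eq_l2dot D E f g g' : D `<=` E -> L2 mu D f ->
  L2 mu E g -> L2 mu E g' -> g = g' %[ae mu in D] ->
  l2dot mu D f g = l2dot mu D f g'.
Proof.
move=> DE Lf Lg Lg' gg'; rewrite !(l2dotE DE)//.
apply: eq_bigr => i _; apply: eq_bigr => j _; congr fine.
move/L2P : Lf => Lf; move/L2P : Lg => Lg; move/L2P : Lg' => Lg'.
apply: ae_eq_integral => //.
- by apply/measurable_EFinP/measurable_funM; [case: (Lf i j)|case: (Lg i j)].
- by apply/measurable_EFinP/measurable_funM; [case: (Lf i j)|case: (Lg' i j)].
apply: filterS gg' => x gx _; rewrite !entryE.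
case: ifPn => [xD|]; last by rewrite !mul0r.
by rewrite gx//; exact: set_mem.
Qed.

Lemma le_l2dot D K f g f' g' : L2 mu D f -> L2 mu D g -> L2 mu D f' ->
  L2 mu D g' ->
  (forall x, D x -> ddot (f x) (g x) <= K * ddot (f' x) (g' x)) ->
  l2dot mu D f g <= K * l2dot mu D f' g'.
Proof.
have DE := @subset_refl _ D.
move=> Lf Lg Lf' Lg' H; rewrite !(l2dotE DE)//.
move/L2P : Lf => Lf; move/L2P : Lg => Lg.
move/L2P : Lf' => Lf'; move/L2P : Lg' => Lg'.
have I p q : (forall i j, sqint mu (entry D p i j)) ->
  (forall i j, sqint mu (entry D q i j)) ->
  mu.-integrable setT (fun x => (\sum_i \sum_j entry D p i j x * entry D q i j x)%:E) /\
  \sum_i \sum_j \int[mu]_x (entry D p i j x * entry D q i j x) =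
  \int[mu]_x (\sum_i \sum_j entry D p i j x * entry D q i j x).
  move=> sp sq; have iij i j := sqint_mul (sp i j) (sq i j).
  split; first by apply: (Rintegral_sumT _ _).1 => i; exact: (Rintegral_sumT _ _).1.
  rewrite (Rintegral_sumT _ _).2.
    by apply: eq_bigr => i _; rewrite (Rintegral_sumT _ _).2.
  by move=> i; exact: (Rintegral_sumT _ _).1.
have iK := integrableZl measurableT K (I _ _ Lf' Lg').1.
rewrite (I _ _ Lf Lg).2 (I _ _ Lf' Lg').2 -RintegralZl//; last exact: (I _ _ Lf' Lg').1.
apply: le_Rintegral => //; first exact: (I _ _ Lf Lg).1.
move=> x _; case: (boolP (x \in D)) => xD.
  have E p q : \sum_i \sum_j entry D p i j x * entry D q i j x = ddot (p x) (q x).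
    by apply: eq_bigr => i _; apply: eq_bigr => j _; rewrite !entryE xD.
  by rewrite !E; exact/H/set_mem.
have E p q : \sum_i \sum_j entry D p i j x * entry D q i j x = 0.
  by rewrite big1// => i _; rewrite big1// => j _; rewrite entryE (negbTE xD) mul0r.
by rewrite !E mulr0.
Qed.

Lemma l2dot_ge0 D f : 0 <= l2dot mu D f f.
Proof.
apply: Rintegral_ge0 => x _; apply: sumr_ge0 => i _; apply: sumr_ge0 => j _.
by rewrite -expr2 sqr_ge0.
Qed.

End L2_fields.

(** * Completeness of L^2 for matrix fields *)

Section L2_complete.
Context d (T : measurableType d) (R : realType) (mu : {measure set T -> \bar R}).
Context (m n : nat) (D : set T).
Variables (f : nat -> T -> 'M[R]_(m, n)) (c : R).
Hypothesis Lf : forall k, L2 mu D (f k).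
Hypothesis fc : forall p q, (p <= q)%N ->
  l2dot mu D (fun x => f q x - f p x) (fun x => f q x - f p x) <= c * 8^-1 ^+ p.

Definition L2_lim x : 'M[R]_(m, n) :=
  \matrix_(i, j) sqint_lim (fun k => entry D (f k) i j) x.

Let sf k i j : sqint mu (entry D (f k) i j).
Proof. by have /L2P := Lf k. Qed.

Let entry_sub (g h : T -> 'M[R]_(m, n)) i j x :
  entry D (fun x => g x - h x) i j x = entry D g i j x - entry D h i j x.
Proof. by rewrite !entryE; case: ifP => _; rewrite ?mxE// subr0. Qed.

Let L2B (g h : T -> 'M[R]_(m, n)) : L2 mu D g -> L2 mu D h ->
  L2 mu D (fun x => g x - h x).
Proof.
by move=> Lg Lh; have := L2_lin (-1) Lh Lg; under eq_fun do rewrite scaleN1r addrC.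
Qed.

Let fcij i j p q : (p <= q)%N ->
  \int[mu]_x ((entry D (f q) i j x - entry D (f p) i j x) ^+ 2) <= c * 8^-1 ^+ p.
Proof.
move=> pq; apply: le_trans (fc pq).
rewrite (l2dotE (@subset_refl _ D)); [|exact: L2B..].
have int0 k l : 0 <= \int[mu]_x (entry D (fun x => f q x - f p x) k l x *
    entry D (fun x => f q x - f p x) k l x).
  by apply: Rintegral_ge0 => x _; rewrite -expr2 sqr_ge0.
rewrite (bigD1 i)//= (bigD1 j)//= -addrA.
under eq_Rintegral do rewrite -entry_sub expr2.
by rewrite lerDl addr_ge0// sumr_ge0// => k _; rewrite sumr_ge0.
Qed.

(** Off [D] all extended entries are 0 and so is their upper limit, hence cutting off to [D] changes
    nothing. *)
Lemma entry_L2_lim i j :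
  entry D L2_lim i j = sqint_lim (fun k => entry D (f k) i j).
Proof.
apply/funext => x; rewrite entryE mxE; case: ifPn => // xD.
rewrite /sqint_lim (_ : limn_esup _ = 0%:E)//.
apply: (cvg_limn_einf_sup _).2.
under eq_fun do rewrite entryE (negbTE xD).
exact: cvg_cst.
Qed.

Lemma L2_L2_lim : L2 mu D L2_lim.
Proof. by apply/L2P => i j; rewrite entry_L2_lim; exact: sqint_sqint_lim (fcij i j). Qed.

Lemma L2_lim_cvg : {ae mu, forall x, D x -> forall i j,
  (fun k => f k x i j) @ \oo --> L2_lim x i j}.
Proof.
have H (i : 'I_m) : \forall x \ae mu, forall j, D x ->
    (fun k => f k x i j) @ \oo --> L2_lim x i j.
  apply: filter_forall => j.
  have := sqint_lim_cvg (fun k => sf k i j) (fcij i j).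
  apply: filterS => x + Dx; rewrite mxE.
  by under eq_fun do rewrite entryE mem_set//.
have {}H : \forall x \ae mu, forall i j, D x ->
    (fun k => f k x i j) @ \oo --> L2_lim x i j by exact: filter_forall.
by apply: filterS H => x Hx Dx i j; exact: Hx.
Qed.

Lemma L2_lim_dist k :
  l2dot mu D (fun x => L2_lim x - f k x) (fun x => L2_lim x - f k x)
  <= (m * n)%:R * (c * 8^-1 ^+ k).
Proof.
rewrite (l2dotE (@subset_refl _ D)); [|exact: L2B L2_L2_lim _..].
apply: (@le_trans _ _ (\sum_(i < m) \sum_(j < n) (c * 8^-1 ^+ k))).
  apply: ler_sum => i _; apply: ler_sum => j _.
  under eq_Rintegral do rewrite -expr2 entry_sub entry_L2_lim.
  exact: sqint_lim_dist (fcij i j) k.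
by rewrite !sumr_const !card_ord -mulrnA mulr_natl (mulnC n m).
Qed.

End L2_complete.

(** * Borel sets of row vectors and compactly supported functions *)

Section row_vectors.
Context (R : realType) (n : nat).

Lemma measurable_rv_coord i : measurable_fun setT (@rv_coord R n i).
Proof.
move=> _ B mB; apply: sub_sigma_algebra.
case: n i => [[]//|k] i; rewrite -bigcup_mkord_ord.
exists i; first exact: ltn_ord.
exists B => //.
rewrite (_ : inord i = i)//; by apply/val_inj; rewrite /= inordK.
Qed.

(** The sigma-algebra is generated by the coordinates, and an open set is the countable union of the
    boxes with rational centre and radius 1/(k+1) that it contains. *)
Lemma open_measurable_rV (U : set 'rV[R]_n) : open U -> measurable U.
Proof.
move=> oU.
pose box (p : {ffun 'I_n -> rat} * nat) : set 'rV[R]_n :=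
  \bigcap_(i in [set: 'I_n]) (@rv_coord R n i @^-1`
    [set y : R | `|y - ratr (p.1 i)| < p.2.+1%:R^-1]).
have mbox p : measurable (box p).
  apply: fin_bigcap_measurable => // i _; rewrite -[X in measurable X]setTI.
  apply: measurable_rv_coord => //.
  rewrite (_ : [set _ | _] = ball (ratr (p.1 i) : R) p.2.+1%:R^-1).
    exact: measurable_ball.
  by apply/seteqP; split=> y; rewrite /ball/= /ball_ distrC.
rewrite (_ : U = \bigcup_p if `[< box p `<=` U >] then box p else set0).
  apply: countable_bigcupT_measurable => // p.
  by case: ifP => _; [exact: mbox|exact: measurable0].
apply/seteqP; split=> [x Ux|x [p _]]; last by case: asboolP => // /[apply].
have /nbhs_ballP[e /= e0 eU] := open_nbhs_nbhs (conj oU Ux).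
(* Half of [e], because the box is centred at a rational point near [x] and not at [x] itself. *)
have /ltr_add_invr[k] : 0 < e / 2 by rewrite divr_gt0.
rewrite add0r => ke.
have k0 : 0 < k.+1%:R^-1 :> R by rewrite invr_gt0.
have H i : exists q : rat, `|x ord0 i - ratr q| < k.+1%:R^-1.
  have [|q /itvP qx] := @rat_in_itvoo R (x ord0 i - k.+1%:R^-1) (x ord0 i).
    by rewrite ltrBlDr ltrDl.
  exists q; rewrite ltr_norml; apply/andP; split.
    by rewrite (lt_trans (y := 0)) ?oppr_lt0// subr_gt0 qx.
  by rewrite ltrBlDl -ltrBlDr qx.
have [q qx] := choice H.
exists ([ffun i => q i], k) => //.
have bx : box ([ffun i => q i], k) x.
  by move=> i _; rewrite /= ffunE; exact: qx.
case: asboolP => // -[] y by_; apply: eU; split => // i j; rewrite ord1.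
have := by_ j I; have := bx j I; rewrite /= /rv_coord => xj yj; rewrite /ball/=.
rewrite -(subrKA (ratr ([ffun i => q i] j))) (le_lt_trans (ler_normD _ _))//.
by rewrite (splitr e) ltrD// (lt_trans _ ke)// distrC//.
Qed.

Lemma continuous_measurable_rV (phi : 'rV[R]_n -> R) :
  continuous phi -> measurable_fun setT phi.
Proof.
move=> /continuousP cphi.
apply: (measurability _ (RGenOpens.measurableE R)).
move=> _ [_ [a [b ->] <-]]; rewrite setTI.
by apply: open_measurable_rV; apply: cphi; exact: interval_open.
Qed.

End row_vectors.

Section test_functions.
Context (R : realType).
Implicit Types (phi : 'rV[R]_3 -> R).

Definition cube (M : R) : set 'rV[R]_3 :=
  \bigcap_(i in [set: 'I_3]) (@rv_coord R 3 i @^-1` `[- M, M]).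

Lemma measurable_cube M : measurable (cube M).
Proof.
apply: fin_bigcap_measurable => // i _; rewrite -[X in measurable X]setTI.
exact: measurable_rv_coord.
Qed.

Lemma lebesgue3_cube M : (lebesgue3 (cube M) < +oo)%E.
Proof.
rewrite /lebesgue3/= /pushforward.
pose I : set (measurableTypeR R) := `[- M, M]%classic.
have mI : measurable I by exact: measurable_itv.
have -> : @rv3 R @^-1` cube M = (I `*` I) `*` I.
  apply/seteqP; split=> [[[a b] c] H|[[a b] c] [[/= Ha Hb] Hc] i _].
    split; first split.
    - by have := H (@Ordinal 3 0 isT) Logic.I; rewrite /= /rv_coord mxE.
    - by have := H (@Ordinal 3 1 isT) Logic.I; rewrite /= /rv_coord mxE.
    - by have := H (@Ordinal 3 2 isT) Logic.I; rewrite /= /rv_coord mxE.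
  by rewrite /= /rv_coord mxE; case: i => [[|[|[|]]]].
rewrite product_measure1E//; last exact: measurableX.
rewrite [X in (X * _)%E]product_measure1E//.
have foo : (@lebesgue_measure R I < +oo)%E.
  by rewrite lebesgue_measure_itv/=; case: ifP => _; rewrite ?ltry// -EFinB ltry.
by rewrite lte_mul_pinfty// ?ge0_fin_numE// ?mule_ge0// lte_mul_pinfty// ge0_fin_numE.
Qed.

Lemma bounded_sub_cube (A : set 'rV[R]_3) : bounded_set A ->
  exists M, A `<=` cube M.
Proof.
move=> [M [_ /(_ (M + 1))]]; rewrite ltrDl => /(_ ltr01) AM.
exists (M + 1) => x /AM xM i _; rewrite /= in_itv/= -ler_norml /rv_coord.
apply: le_trans xM; rewrite [leRHS]/Num.Def.normr/= mx_normrE.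
by apply/bigmax_geP; right; exists (ord0, i).
Qed.

(** The function is bounded on [K], so its square is dominated by a multiple of the indicator of a
    cube, which has finite measure. *)
Lemma sqint_compact_support phi (K : set 'rV[R]_3) : continuous phi -> compact K ->
  (forall x, ~ K x -> phi x = 0) -> sqint lebesgue3 phi.
Proof.
move=> cphi cK phi0.
have mphi := continuous_measurable_rV cphi.
have [M KM] := bounded_sub_cube (compact_bounded cK).
have [B phiB] : exists B, forall x, phi x ^+ 2 <= B ^+ 2 * \1_(cube M) x.
  have : bounded_set (phi @` K).
    apply: compact_bounded; apply: continuous_compact => //.
    exact: continuous_subspaceT.
  move=> [B [_ /(_ (B + 1))]]; rewrite ltrDl => /(_ ltr01) HB.
  exists (B + 1) => x; have [Kx|nKx] := pselect (K x).
    rewrite indicE mem_set; last exact: KM.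
    have pB : `|phi x| <= B + 1 by apply: HB; exists x.
    rewrite mulr1 -(real_normK (num_real (phi x))).
    by rewrite ler_pXn2r// ?nnegrE// (le_trans _ pB).
  by rewrite phi0// expr0n mulr_ge0// sqr_ge0.
split => //; apply: (le_integrable_fin (h := fun x => B ^+ 2 * \1_(cube M) x)).
- exact: measurable_funX.
- by move=> x; rewrite ger0_norm// sqr_ge0.
under eq_fun do rewrite EFinM.
apply: integrableZl => //; apply/integrableP; split.
  by apply/measurable_EFinP; apply: measurable_indic; exact: measurable_cube.
under eq_integral do rewrite gee0_abs ?lee_fin//.
by rewrite integral_indic// ?setIT; [exact: lebesgue3_cube|exact: measurable_cube].
Qed.

End test_functions.

(** * Linear structure of the Sobolev and load functionals *)

Section sobolev_linear.
Context (R : realType) (Omega : set 'rV[R]_3).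
Implicit Types (v w : field1 R).

Lemma test_function_sqint phi : test_function Omega phi -> sqint lebesgue3 phi.
Proof.
move=> [sphi cK _]; apply: (sqint_compact_support _ cK).
  by move=> x; apply: differentiable_continuous; exact: (sphi [::]).
move=> x nKx; apply/eqP; apply: contra_notT nKx => phix.
exact: subset_closure.
Qed.

Lemma pderiv_sqint phi j : test_function Omega phi ->
  sqint lebesgue3 (pderiv j phi).
Proof.
move=> [sphi cK _]; apply: (sqint_compact_support _ cK).
  by move=> x; apply: differentiable_continuous; exact: (sphi [:: j]).
move=> x nKx; rewrite /pderiv.
(* The complement of the support is open, so [phi] vanishes on a neighbourhood of [x]. *)
rewrite (@near_eq_derive _ _ _ _ (cst 0)); first by rewrite derive_cst.
have oC : open (~` closure [set x | phi x != 0]).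
  exact/closed_openC/closed_closure.
have := open_nbhs_nbhs (conj oC nKx).
apply: filterS => y nKy; apply/eqP; apply: contra_notT nKy => phiy.
exact: subset_closure.
Qed.

Lemma Rintegral_entry m n (v : 'rV[R]_3 -> 'M[R]_(m, n)) i j (phi : 'rV[R]_3 -> R) :
  \int[lebesgue3]_(x in Omega) (v x i j * phi x) =
  \int[lebesgue3]_x (entry Omega v i j x * phi x).
Proof.
rewrite Rintegral_mkcond; apply: eq_Rintegral => x _.
by rewrite patchE entryE; case: ifP => // _; rewrite mul0r.
Qed.

(** Test functions and their derivatives are square integrable, which makes all the products
    integrable and the integrals additive. *)
Lemma weak_gradient_lin a v w : H1 Omega v -> H1 Omega w ->
  weak_gradient Omega (lin1 a v w).1 (lin1 a v w).2.
Proof.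
move=> [/L2P Lv1 /L2P Lv2 gv] [/L2P Lw1 /L2P Lw2 gw] phi tphi i j.
have := gv phi tphi i j; have := gw phi tphi i j.
rewrite !Rintegral_entry => gw' gv'.
under eq_Rintegral do rewrite entry_lin.
rewrite Rintegral_sqint_linl//; last exact: pderiv_sqint.
under [in RHS]eq_Rintegral do rewrite entry_lin.
rewrite Rintegral_sqint_linl//; last exact: test_function_sqint.
by rewrite gv' gw' mulrN opprD.
Qed.

Lemma H1_lin1 a v w : H1 Omega v -> H1 Omega w -> H1 Omega (lin1 a v w).
Proof.
move=> Hv Hw; split; last exact: weak_gradient_lin.
  by apply: L2_lin; [case: Hv|case: Hw].
by apply: L2_lin; [case: Hv|case: Hw].
Qed.

(* Without the trace theorem [trace] may be the default value [0] of [xget],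
   which has these properties as well. *)
Lemma trace_linear :
  (forall v, H1 Omega v -> L2 surf (bdry Omega) (trace Omega v)) /\
  (forall a v w, H1 Omega v -> H1 Omega w ->
    (trace Omega (lin1 a v w) : surfT R -> 'rV[R]_3) =
    (fun x => a *: trace Omega v x + trace Omega w x) %[ae surf in bdry Omega]).
Proof.
have [exT|nexT] := pselect (exists T, is_trace Omega T).
  by have [? ?] := xgetPex (fun _ _ => 0) exT.
have -> : trace Omega = fun _ _ => 0.
  by apply: xgetPN => T tT; apply: nexT; exists T.
split=> [v _|a v w _ _]; first exact: L2_0.
by apply: aeW => x _ /=; rewrite scaler0 addr0.
Qed.

Lemma sym_gradE v x i j : sym_grad v x i j = 2^-1 * v.2 x i j + 2^-1 * v.2 x j i.
Proof. by rewrite /sym_grad !mxE mulrDr. Qed.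

Lemma sym_grad_lin1 a v w :
  sym_grad (lin1 a v w) = fun x => a *: sym_grad v x + sym_grad w x.
Proof.
by apply/funext => x; apply/matrixP => i j; rewrite sym_gradE !mxE; lra.
Qed.

Lemma sym_grad_stresses v : H1 Omega v -> stresses Omega (sym_grad v).
Proof.
move=> [_ /L2P Lv _]; split.
  apply/L2P => i j.
  rewrite (_ : entry _ _ _ _ = (fun x => 2^-1 * entry Omega v.2 i j x +
      (2^-1 * entry Omega v.2 j i x + 0))).
    by apply: sqint_lin => //; apply: sqint_lin => //; exact: sqint0.
  apply/funext => x; rewrite !entryE; case: ifP => _.
    by rewrite sym_gradE addr0.
  by rewrite !mulr0 !addr0.
move=> x _; rewrite /sym3 /= /sym_grad linearZ/= linearD/= trmxK addrC//.
Qed.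

Context (GD GN : set 'rV[R]_3).
Hypothesis hG : boundary_parts Omega GD GN.

Let GDb : GD `<=` bdry Omega.
Proof. by case: hG => -[U oU ->] _ _ _ _; exact: subIsetl. Qed.

Let GNb : GN `<=` bdry Omega.
Proof. by case: hG => _ [U oU ->] _ _ _; exact: subIsetl. Qed.

Lemma Vspace_lin1 a v w : Vspace Omega GD v -> Vspace Omega GD w ->
  Vspace Omega GD (lin1 a v w).
Proof.
move=> [Hv v0] [Hw w0]; split; first exact: H1_lin1.
have := trace_linear.2 a _ _ Hv Hw.
move: v0 w0; apply: (@filterS3 _ _ (ae_filter_ringOfSetsType (@surf R))) => x v0 w0 H Gx.
by rewrite H ?v0 ?w0 ?scaler0 ?addr0//; exact: GDb.
Qed.

Lemma load_lin1 (F f : 'rV[R]_3 -> 'rV[R]_3) a v w :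
  L2 lebesgue3 Omega F -> L2 surf GN f ->
  H1 Omega v -> H1 Omega w ->
  load Omega GN F f (lin1 a v w) =
  a * load Omega GN F f v + load Omega GN F f w.
Proof.
move=> LF Lf Hv Hw; rewrite /load.
rewrite (l2dot_linr _ (@subset_refl _ Omega))//; [|by case: Hv|by case: Hw].
have [tL tlin] := trace_linear.
have Ltv := tL _ Hv; have Ltw := tL _ Hw.
(* The trace is linear only almost everywhere on the boundary, so the combination is exchanged under
   the integral. *)
rewrite (ae_eq_l2dot (T := surfT R) GNb Lf (tL _ (H1_lin1 a Hv Hw)) (L2_lin a Ltv Ltw)); last first.
  by have := tlin a _ _ Hv Hw; apply: (@filterS _ _ (ae_filter_ringOfSetsType (@surf R))) => x H /GNb /H.
by rewrite (l2dot_linr (T := surfT R) _ GNb)//; ring.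
Qed.

End sobolev_linear.

(** * Inverse of the elasticity map *)

Section frobenius.
Context (R : realType) (m n : nat).
Implicit Types A B : 'M[R]_(m, n).

Lemma ddotC A B : ddot A B = ddot B A.
Proof. by apply: eq_bigr => i _; apply: eq_bigr => j _; rewrite mulrC. Qed.

Lemma ddot_linl a A B D : ddot (a *: A + B) D = a * ddot A D + ddot B D.
Proof.
rewrite mulr_sumr -big_split/=; apply: eq_bigr => i _.
rewrite mulr_sumr -big_split/=; apply: eq_bigr => j _.
by rewrite !mxE; ring.
Qed.

Lemma sqr_le_ddot A i j : A i j ^+ 2 <= ddot A A.
Proof.
rewrite /ddot (bigD1 i)//= (bigD1 j)//= -addrA -expr2 lerDl addr_ge0//.
  by apply: sumr_ge0 => k _; rewrite -expr2 sqr_ge0.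
by apply: sumr_ge0 => k _; apply: sumr_ge0 => l _; rewrite -expr2 sqr_ge0.
Qed.

Lemma ddot_ge0 A : 0 <= ddot A A.
Proof.
by apply: sumr_ge0 => i _; apply: sumr_ge0 => j _; rewrite -expr2 sqr_ge0.
Qed.

Lemma ddot_le0 A : ddot A A <= 0 -> A = 0.
Proof.
move=> A0; apply/matrixP => i j; rewrite mxE; apply/eqP.
by rewrite -sqrf_eq0 eq_le sqr_ge0 (le_trans (sqr_le_ddot A i j)).
Qed.

Lemma ddot_le A B : 2 * ddot A B <= ddot A A + ddot B B.
Proof.
have := ddot_ge0 ((-1) *: A + B).
rewrite ddot_linl !(ddotC _ (_ + _)) !ddot_linl (ddotC B A).
by lra.
Qed.

End frobenius.

(** * Boundedness of linear maps between matrix spaces *)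

Section linear_maps.
Context (R : realType) (m n p q : nat) (L : {linear 'M[R]_(m, n) -> 'M[R]_(p, q)}).

Lemma linear_mxE B i j :
  L B i j = \sum_k \sum_l B k l * L (delta_mx k l) i j.
Proof.
rewrite {1}(matrix_sum_delta B) linear_sum summxE; apply: eq_bigr => k _.
by rewrite linear_sum summxE; apply: eq_bigr => l _; rewrite linearZ mxE.
Qed.

Lemma linear_ddot_bound : exists2 K, 0 < K &
  forall B, ddot (L B) (L B) <= K * ddot B B.
Proof.
pose c i j := \sum_k \sum_l `|L (delta_mx k l) i j|.
have c0 i j : 0 <= c i j by apply: sumr_ge0 => k _; exact: sumr_ge0.
(* Entry (i, j) of [L B] is at most [c i j] times the norm of [B]; adding 1 keeps the constant
   positive when [L] is zero. *)
exists (\sum_i \sum_j c i j ^+ 2 + 1).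
  rewrite ltr_wpDl//; apply: sumr_ge0 => i _.
  by apply: sumr_ge0 => j _; exact: sqr_ge0.
move=> B; rewrite mulrDl mul1r ler_wpDr ?ddot_ge0// mulr_suml; apply: ler_sum => i _.
rewrite mulr_suml; apply: ler_sum => j _.
have B0 := ddot_ge0 B.
rewrite -[X in _ <= _ * X](sqr_sqrtr B0) -exprMn -expr2 -(real_normK (num_real (L B i j))).
rewrite ler_pXn2r// ?nnegrE ?mulr_ge0 ?sqrtr_ge0//.
rewrite linear_mxE mulr_suml (le_trans (ler_norm_sum _ _ _))//.
apply: ler_sum => k _.
rewrite mulr_suml (le_trans (ler_norm_sum _ _ _))//.
apply: ler_sum => l _; rewrite normrM mulrC ler_wpM2l//.
by rewrite -sqrtr_sqr ler_wsqrtr// sqr_le_ddot.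
Qed.

Context d (T : measurableType d) (mu : {measure set T -> \bar R}).

Lemma L2_linear D (f : T -> 'M[R]_(m, n)) :
  L2 mu D f -> L2 mu D (L \o f).
Proof.
move=> /L2P Lf; apply/L2P => i j.
have sums (I : Type) (r : seq I) (g : I -> T -> R) : (forall k, sqint mu (g k)) ->
    sqint mu (fun x => \sum_(k <- r) g k x).
  move=> sg; elim: r => [|k r IH].
    by under eq_fun do rewrite big_nil; exact: sqint0.
  have := sqint_lin 1 (sg k) IH.
  by under eq_fun do rewrite mul1r; under [X in _ -> _ _ X]eq_fun do rewrite big_cons.
have -> : entry D (L \o f) i j = (fun x => \sum_k \sum_l
    (L (delta_mx k l) i j * entry D f k l x + 0)).
  apply/funext => x; rewrite entryE; case: ifPn => xD.
    rewrite /= linear_mxE; apply: eq_bigr => k _; apply: eq_bigr => l _.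
    by rewrite entryE xD addr0 mulrC.
  rewrite big1// => k _; rewrite big1// => l _.
  by rewrite entryE (negbTE xD) mulr0 addr0.
apply: (sums) => k; apply: (sums) => l; apply: sqint_lin => //; exact: sqint0.
Qed.

End linear_maps.

Section elasticity_inverse.
Context (R : realType) (C : {linear 'M[R]_3 -> 'M[R]_3}).
Hypothesis hC : elasticity C.
Local Notation sym3 := (@sym3 R).

Lemma sym3P (A : 'M[R]_3) : sym3 A <-> A^T = A.
Proof. by []. Qed.

Lemma sym3_lin a (A B : 'M[R]_3) : sym3 A -> sym3 B -> sym3 (a *: A + B).
Proof. by move=> sA sB; rewrite sym3P linearD linearZ/= sA sB. Qed.

Lemma elasticity_inj A : sym3 A -> C A = 0 -> A = 0.
Proof.
case: hC => _ _ [del del0 Cd] sA CA0; apply: ddot_le0.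
have := Cd A sA; rewrite CA0.
have -> : ddot 0 A = 0 :> R.
  by rewrite /ddot big1// => i _; rewrite big1// => j _; rewrite mxE mul0r.
by rewrite pmulr_rle0.
Qed.

(** Acts as [C] on the symmetric part and as the identity on the skew part, so that it is invertible
    on all matrices. *)
Let Cext (A : 'M[R]_3) : 'M[R]_3 := C (2^-1 *: (A + A^T)) + 2^-1 *: (A - A^T).

Let Cext_linear : linear Cext.
Proof.
move=> a A B; rewrite /Cext.
have -> : 2^-1 *: (a *: A + B + (a *: A + B)^T) =
    a *: (2^-1 *: (A + A^T)) + 2^-1 *: (B + B^T).
  by apply/matrixP => i j; rewrite !mxE; ring.
have -> : 2^-1 *: (a *: A + B - (a *: A + B)^T) =
    a *: (2^-1 *: (A - A^T)) + 2^-1 *: (B - B^T).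
  by apply/matrixP => i j; rewrite !mxE; ring.
by rewrite linearP (scalerDr a (C _)) addrACA.
Qed.

HB.instance Definition _ := GRing.isLinear.Build R 'M[R]_3 'M[R]_3 _ Cext Cext_linear.

Let sym_part (A : 'M[R]_3) : sym3 (2^-1 *: (A + A^T)).
Proof. by rewrite sym3P; apply/matrixP => i j; rewrite !mxE addrC. Qed.

Let sym_skew (A : 'M[R]_3) : A = 2^-1 *: (A + A^T) + 2^-1 *: (A - A^T).
Proof. by apply/matrixP => i j; rewrite !mxE; lra. Qed.

Let skew_eq (S K : 'M[R]_3) B : sym3 S -> K^T = - K -> sym3 B -> S + K = B ->
  K = 0 /\ S = B.
Proof.
move=> sS kK sB SK; have K0 : K = 0.
  have : (S + K)^T = S + K by rewrite SK.
  rewrite linearD/= sS kK => /addrI/eqP; rewrite eq_sym -subr_eq0 opprK -mulr2n.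
  by rewrite -scaler_nat scaler_eq0 pnatr_eq0/= => /eqP.
by split => //; rewrite -SK K0 addr0.
Qed.

Let skew_part (A : 'M[R]_3) : (2^-1 *: (A - A^T))^T = - (2^-1 *: (A - A^T)).
Proof. by apply/matrixP => i j; rewrite !mxE; ring. Qed.

Let Cext_ker0 : lker (linfun Cext) == 0%VS.
Proof.
apply/lker0P => A B; rewrite !lfunE => /eqP; rewrite -subr_eq0 -linearB => /eqP.
have [Csym _ _] := hC.
move=> AB0; apply/eqP; rewrite -subr_eq0; apply/eqP.
have [K0 S0] := skew_eq (Csym _ (sym_part (A - B))) (skew_part (A - B))
  (trmx0 _ _ _) AB0.
have := elasticity_inj (sym_part _) S0.
move=> S1; rewrite (sym_skew (A - B)) S1 add0r; exact: K0.
Qed.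

(** [Cinv] is a partial inverse, not linear by construction. The inverse of [Cext] is linear and
    agrees with it on symmetric matrices. *)
Lemma elasticity_inverse : exists D : {linear 'M[R]_3 -> 'M[R]_3},
  forall B, sym3 B -> [/\ sym3 (D B), C (D B) = B & Cinv C B = D B].
Proof.
have [Csym _ _] := hC.
pose D := (linfun Cext)^-1%VF.
have DK B : sym3 B -> exists2 A, sym3 A & C A = B.
  move=> sB; pose A := D B.
  have := lker0_lfunVK Cext_ker0 B; rewrite lfunE/= -/D -/A => AB.
  have [_ CB] := skew_eq (Csym _ (sym_part A)) (skew_part A) sB AB.
  by exists (2^-1 *: (A + A^T)).
have DC A : sym3 A -> D (C A) = A.
  move=> sA; rewrite -[RHS](lker0_lfunK Cext_ker0) lfunE/=; congr (D _).
  rewrite /Cext sA subrr scaler0 addr0; congr (C _).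
  by rewrite {1}(sym_skew A) sA subrr scaler0 addr0.
exists D => B sB; have [A sA CA] := DK _ sB.
have DB : D B = A by rewrite -CA DC.
split; [by rewrite -DB in sA|by rewrite -DB in CA|].
transitivity A; last by rewrite -DB.
rewrite -{1}CA /Cinv pinvKV//; last exact: mem_set.
move=> X Y /set_mem sX /set_mem sY /eqP; rewrite -subr_eq0 -linearB => /eqP CXY.
apply/eqP; rewrite -subr_eq0; apply/eqP/elasticity_inj => //.
by rewrite -scaleN1r addrC; exact: sym3_lin.
Qed.

End elasticity_inverse.

(** * The energy form and projections onto closed convex sets of stresses *)

(** Stands in for letting a small parameter h = 2^(-n) tend to 0. *)
Lemma le_exp2N (R : realType) (x y c : R) :
  (forall n, x <= y + c * 2^-1 ^+ n) -> x <= y.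
Proof.
move=> H; rewrite leNgt; apply/negP => yx.
have c0 : 0 < c by have := H 0; rewrite expr0 mulr1; lra.
have [k] : exists k, 0 + k.+1%:R^-1 < (x - y) / c.
  by apply: ltr_add_invr; rewrite divr_gt0// subr_gt0.
rewrite add0r ltr_pdivlMr// mulrC => kc.
have := H k; apply/negP; rewrite -ltNge -ltrBrDl; apply: le_lt_trans kc.
rewrite ler_pM2l// exprVn lef_pV2 ?posrE ?exprn_gt0//.
by rewrite -natrX ler_nat ltn_expl.
Qed.

Section energy_form.
Context (R : realType) (Omega : set 'rV[R]_3) (C : {linear 'M[R]_3 -> 'M[R]_3}).
Hypothesis hC : elasticity C.
Local Notation stress := ('rV[R]_3 -> 'M[R]_3).
Local Notation S := (stresses Omega).
Local Notation sdot := (sdot Omega).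
Implicit Types (s t e p : stress).

(** In particular [lc (-1) s t] is the difference t - s. *)
Definition lc (a : R) s t : stress := fun x => a *: s x + t x.

(** The scalar product whose norm is [cnorm]. *)
Definition qform s t := sdot (Cinv C \o s) t.

Lemma subE s t : (fun x => s x - t x) = lc (-1) t s.
Proof. by apply/funext => x; rewrite /lc scaleN1r addrC. Qed.

Lemma stresses_lin a s t : S s -> S t -> S (lc a s t).
Proof.
move=> [Ls ss] [Lt st]; split; first exact: L2_lin.
by move=> x Ox; apply: sym3_lin; [exact: ss|exact: st].
Qed.
Local Hint Resolve stresses_lin : core.

Lemma stresses0 : S (fun=> 0).
Proof. by split; [exact: L2_0|move=> x _; rewrite sym3P trmx0]. Qed.

Lemma stresses_C e : S e -> S (C \o e).
Proof.
move=> [Le se]; split; first exact: L2_linear.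
by move=> x Ox; case: hC => Cs _ _; apply: Cs; exact: se.
Qed.

Lemma sdotC s t : sdot s t = sdot t s.
Proof. exact: l2dotC. Qed.

Lemma sdot_linl a s t e : S s -> S t -> S e ->
  sdot (lc a s t) e = a * sdot s e + sdot t e.
Proof. by move=> [Ls _] [Lt _] [Le _]; exact: l2dot_linl. Qed.

Lemma sdot_linr a s t e : S s -> S t -> S e ->
  sdot e (lc a s t) = a * sdot e s + sdot e t.
Proof. by move=> *; rewrite sdotC sdot_linl// !(sdotC _ e). Qed.

Lemma Cinv_stress : exists D : {linear 'M[R]_3 -> 'M[R]_3},
  (forall s t, S s -> sdot (Cinv C \o s) t = sdot (D \o s) t) /\
  forall s, S s -> S (D \o s) /\ forall x, Omega x -> Cinv C (s x) = D (s x) /\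
    C (D (s x)) = s x.
Proof.
have [D HD] := elasticity_inverse hC; exists D; split=> [s t [Ls ss]|s [Ls ss]].
  apply: eq_l2dot => // x /set_mem Ox /=.
  by have [_ _ ->] := HD _ (ss _ Ox).
split; first split; first exact: L2_linear.
  by move=> x Ox; have [] := HD _ (ss _ Ox).
by move=> x Ox; have [_ ? ?] := HD _ (ss _ Ox).
Qed.

Lemma qform_linl a s t e : S s -> S t -> S e ->
  qform (lc a s t) e = a * qform s e + qform t e.
Proof.
have [D [DE DS]] := Cinv_stress.
move=> Ss St Se; rewrite /qform !DE//; last exact: stresses_lin.
rewrite -sdot_linl//; [|by case: (DS _ Ss)|by case: (DS _ St)].
by apply: eq_l2dot => // x _; rewrite /= /lc linearP.
Qed.

(** Writing s = C a and t = C b on [Omega], the claim reduces pointwise to the symmetry of [C]. *)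
Lemma qformC s t : S s -> S t -> qform s t = qform t s.
Proof.
have [D [DE DS]] := Cinv_stress.
move=> Ss St; rewrite /qform sdotC; apply: eq_Rintegral => x /set_mem Ox /=.
have [[_ Dss] /(_ _ Ox)[-> CDs]] := DS _ Ss.
have [[_ Dst] /(_ _ Ox)[-> CDt]] := DS _ St.
rewrite -{1}CDt -{2}CDs; case: hC => _ Csym _.
by rewrite Csym; [rewrite ddotC|exact: Dst|exact: Dss].
Qed.

Lemma qform_linr a s t e : S s -> S t -> S e ->
  qform e (lc a s t) = a * qform e s + qform e t.
Proof.
by move=> Ss St Se; rewrite !(qformC Se)// ?qform_linl//; exact: stresses_lin.
Qed.

Lemma qform_C e t : S e -> S t -> qform (C \o e) t = sdot e t.
Proof.
move=> Se [_ st]; apply: eq_l2dot => // x /set_mem Ox /=.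
have [D [_ DS]] := Cinv_stress.
have [[_ DCs] /(_ _ Ox)[/= -> CDC]] := DS _ (stresses_C Se).
apply/eqP; rewrite -subr_eq0; apply/eqP/(elasticity_inj hC).
  by rewrite -scaleN1r addrC; apply: sym3_lin; [case: Se => _; apply|exact: DCs].
by rewrite linearB/= CDC subrr.
Qed.

(** With s = C a, boundedness gives |s|^2 <= K |a|^2, and coercivity gives delta |a|^2 <= C a : a =
    s : a. *)
Lemma sdot_le_qform : exists2 K, 0 < K &
  forall s, S s -> sdot s s <= K * qform s s.
Proof.
have [K K0 HK] := linear_ddot_bound C.
have [_ _ [del del0 Cdel]] := hC.
have [D [DE DS]] := Cinv_stress.
exists (K / del); first by rewrite divr_gt0.
move=> s Ss; rewrite /qform DE//; have [[LD sD] DC] := DS _ Ss.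
apply: le_l2dot; [exact: Ss.1..|exact: LD|exact: Ss.1|] => x Ox.
have [_ CD] := DC _ Ox.
have := HK (D (s x)); rewrite CD => /le_trans; apply.
rewrite -mulrA ler_pM2l// ler_pdivlMl//.
by have := Cdel _ (sD _ Ox); rewrite CD ddotC.
Qed.

Lemma qform_le_sdot : exists2 K, 0 < K &
  forall s, S s -> qform s s <= K * sdot s s.
Proof.
have [D [DE DS]] := Cinv_stress.
have [K K0 HK] := linear_ddot_bound D.
exists (2^-1 * (K + 1)); first by rewrite mulr_gt0// addr_gt0.
move=> s Ss; rewrite /qform DE//; have [[LD _] _] := DS _ Ss.
apply: le_l2dot; [exact: LD|exact: Ss.1..|] => x Ox.
by have := HK (s x); have := ddot_le (D (s x)) (s x); rewrite /=; lra.
Qed.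

Lemma qform_ge0 s : S s -> 0 <= qform s s.
Proof.
move=> Ss; have [K K0 HK] := sdot_le_qform.
by have := le_trans (l2dot_ge0 lebesgue3 Omega s) (HK s Ss); rewrite pmulr_rge0.
Qed.

Lemma cnorm_sqr s : S s -> cnorm Omega C s ^+ 2 = qform s s.
Proof. by move=> Ss; rewrite sqr_sqrtr//; exact: qform_ge0. Qed.

Lemma qform_lc a s t : S s -> S t ->
  qform (lc a s t) (lc a s t) =
  a ^+ 2 * qform s s + 2 * a * qform s t + qform t t.
Proof.
move=> Ss St; rewrite qform_linl//; last exact: stresses_lin.
by rewrite !qform_linr// (qformC St Ss); ring.
Qed.

Lemma sdot_lc a s t : S s -> S t ->
  sdot (lc a s t) (lc a s t) =
  a ^+ 2 * sdot s s + 2 * a * sdot s t + sdot t t.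
Proof.
move=> Ss St; rewrite sdot_linl//; last exact: stresses_lin.
by rewrite !sdot_linr// (sdotC t s); ring.
Qed.

(** Expand h |k s + t|^2 >= 0 for k = 1/h and k = -1/h. *)
Lemma sdot_young h s t : 0 < h -> S s -> S t ->
  2 * `|sdot s t| <= h^-1 * sdot s s + h * sdot t t.
Proof.
move=> h0 Ss St.
have H k : h * k ^+ 2 = h^-1 ->
    0 <= h^-1 * sdot s s + 2 * (h * k) * sdot s t + h * sdot t t.
  move=> hk; have := l2dot_ge0 lebesgue3 Omega (lc k s t).
  rewrite -[l2dot _ _ _ _]/(sdot _ _) sdot_lc// => /(mulr_ge0 (ltW h0)).
  by congr (_ <= _); rewrite -hk; ring.
have hn0 : h != 0 by rewrite gt_eqF.
have H1 := H h^-1 ltac:(by field); have H2 := H (- h^-1) ltac:(by field).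
rewrite mulrN divff// in H2; rewrite divff// in H1.
suff : `|sdot s t| <= (h^-1 * sdot s s + h * sdot t t) / 2 by lra.
by rewrite ler_norml; lra.
Qed.

(** Convexity, with the point of the segment written s + a (t - s). *)
Definition segment_closed (K : set stress) := forall a s t, 0 <= a <= 1 ->
  K s -> K t -> K (lc a (lc (-1) s t) s).

(** Closedness under sequences converging both almost everywhere and geometrically in L^2: the first
    mode serves the yield condition, the second the equilibrium equation. *)
Definition fast_closed (K : set stress) := forall (f : nat -> stress) g c,
  (forall n, K (f n)) -> S g ->
  {ae lebesgue3, forall x, Omega x -> forall i j,
    (fun n => f n x i j) @ \oo --> g x i j} ->
  (forall n, sdot (lc (-1) (f n) g) (lc (-1) (f n) g) <= c * 8^-1 ^+ n) ->
  K g.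

(** A minimizing sequence with defect 8^(-n) is rapidly Cauchy by the parallelogram identity; its
    L^2 limit lies in [K] and attains the infimum. *)
Lemma exists_projection (K : set stress) s : K `<=` S -> K !=set0 ->
  segment_closed K -> fast_closed K -> S s ->
  exists2 p, K p & forall t, K t ->
    qform (lc (-1) p s) (lc (-1) p s) <= qform (lc (-1) t s) (lc (-1) t s).
Proof.
move=> KS [t0 Kt0] Kseg Kcl Ss.
pose dst t := qform (lc (-1) t s) (lc (-1) t s).
have dst0 t : K t -> 0 <= dst t.
  by move=> Kt; apply: qform_ge0; apply: stresses_lin => //; exact: KS.
pose m := inf [set dst t | t in K].
have hinf : has_inf [set dst t | t in K].
  by split; [exists (dst t0), t0|exists 0 => _ [t Kt <-]; exact: dst0].
have mle t : K t -> m <= dst t.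
  by move=> Kt; apply: ge_inf; [case: hinf|exists t].
have appr n : exists t, K t /\ dst t < m + 8^-1 ^+ n.
  have e0 : 0 < 8^-1 ^+ n :> R by rewrite exprn_gt0.
  by have [_ [t Kt <-] tm] := inf_adherent e0 hinf; exists t.
have [f fP] := choice appr.
have Kf n : K (f n) by case: (fP n).
have Sf n : S (f n) by exact: KS.
have [c1 c1_gt0 Hc1] := sdot_le_qform.
have [c2 c2_gt0 Hc2] := qform_le_sdot.
have m0 : 0 <= m by apply: lb_le_inf => [|_ [t Kt <-]]; [case: hinf|exact: dst0].
have e8 n k : (n <= k)%N -> 8^-1 ^+ k <= 8^-1 ^+ n :> R.
  by move=> nk; apply: ler_wiXn2l => //; lra.
(* The midpoint lies in [K], so the squared distance of the two terms is at most 2 dst(f_n) + 2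
   dst(f_k) - 4m. *)
have para n k : (n <= k)%N ->
    qform (lc (-1) (f n) (f k)) (lc (-1) (f n) (f k)) <= 4 * 8^-1 ^+ n.
  move=> nk; have := mle _ (Kseg 2^-1 _ _ _ (Kf n) (Kf k)).
  rewrite /dst => /(_ _) H.
  have {H} := H ltac:(lra).
  have [_] := fP n; have [_] := fP k; rewrite /dst.
  rewrite !qform_lc//; [|by do ?apply: stresses_lin..].
  rewrite !qform_linl//; [|by do ?apply: stresses_lin..].
  rewrite (qformC (Sf k) (Sf n)).
  by have := e8 _ _ nk; lra.
pose c := c1 * 4.
have fc (i k : nat) : (i <= k)%N ->
    l2dot lebesgue3 Omega (fun x => f k x - f i x) (fun x => f k x - f i x)
    <= c * 8^-1 ^+ i.
  move=> ik; rewrite subE; apply: le_trans (Hc1 _ _) _; first exact: stresses_lin.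
  by rewrite -mulrA ler_pM2l// para.
pose g : stress := L2_lim Omega f.
have Lg : L2 lebesgue3 Omega g by apply: (L2_L2_lim (c := c)) => // n; case: (Sf n).
have Sg : S g.
  split => // x Ox; rewrite sym3P; apply/matrixP => i j.
  rewrite !mxE /sqint_lim; do 2 f_equal; apply/funext => n; congr EFin.
  rewrite !entryE; case: ifP => // _.
  by have [_ /(_ x Ox)] := Sf n; rewrite sym3P => {1}<-; rewrite mxE.
have fg n : sdot (lc (-1) (f n) g) (lc (-1) (f n) g) <= (3 * 3)%:R * c * 8^-1 ^+ n.
  rewrite -mulrA -!subE; apply: (L2_lim_dist (c := c)) => // k; by case: (Sf k).
have Kg : K g.
  apply: Kcl Kf Sg _ fg; apply: (L2_lim_cvg (c := c)) => // n; by case: (Sf n).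
exists g => // t Kt; apply: le_trans (mle _ Kt).
pose M := c2 * ((3 * 3)%:R * c).
have M0 : 0 <= M by rewrite !mulr_ge0// ltW.
(* Write s - g = a - b with a = s - f_n and b = g - f_n. With h = 2^(-n) one has q(b) <= M h^3 and
   q(a) < m + h^3, so weighting the cross term by h leaves an excess over m of order h. *)
apply: (@le_exp2N _ _ _ (2 * M + m + 2)) => n.
pose a := lc (-1) (f n) s; pose b := lc (-1) (f n) g.
have Sa : S a by exact: stresses_lin.
have Sb : S b by exact: stresses_lin.
have -> : lc (-1) g s = lc (-1) b a.
  by apply/funext => x; rewrite /b /a /lc !scaleN1r opprD opprK addrACA addrN add0r addrC.
have qb : qform b b <= M * (8^-1 ^+ n).
  by rewrite /M -mulrA; apply: (le_trans (Hc2 _ Sb)); rewrite ler_pM2l// fg.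
have qa : qform a a < m + 8^-1 ^+ n by case: (fP n).
pose h : R := 2^-1 ^+ n.
have h0 : 0 < h by rewrite exprn_gt0.
have h0' := ltW h0.
have h1 : h <= 1 by rewrite exprn_ile1//; lra.
have h8 : 8^-1 ^+ n = h ^+ 3.
  by rewrite -exprM mulnC exprM; congr (_ ^+ _); rewrite !exprS expr0; lra.
(* Multiplied by h, this bounds the cross term: -2 q(b, a) <= q(b) / h + h q(a). *)
have := qform_ge0 (stresses_lin h^-1 Sb Sa).
rewrite (qform_lc h^-1 Sb Sa) (qform_lc (-1) Sb Sa).
have -> : h^-1 ^+ 2 * qform b b + 2 * h^-1 * qform b a + qform a a =
    h^-1 * (h^-1 * qform b b + 2 * qform b a + h * qform a a).
  by field; rewrite gt_eqF.
rewrite pmulr_rge0 ?invr_gt0// => H.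
rewrite -/h; rewrite {}h8 in qb qa; clearbody h.
have qbh : h^-1 * qform b b <= M * h ^+ 2.
  by rewrite ler_pdivrMl// (le_trans qb)// le_eqVlt; apply/orP; left; apply/eqP; ring.
have h2 : h ^+ 2 <= h by rewrite expr2 ler_piMl// ltW.
have h3 : h ^+ 3 <= h by rewrite exprS ler_piMr ?exprn_ile1.
have M2 : M * h ^+ 2 <= M * h by rewrite ler_wpM2l.
have M3 : M * h ^+ 3 <= M * h by rewrite ler_wpM2l.
have h1qa : h * qform a a <= h * (m + 1).
  by rewrite ler_pM2l// (le_trans (ltW qa))// lerD2l exprn_ile1.
by lra.
Qed.

End energy_form.

(** * Closedness of the sets of admissible stresses *)

Lemma cvg_mx_entries (R : realType) m n (A_ : nat -> 'M[R]_(m, n)) (A : 'M[R]_(m, n)) :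
  (forall i j, (fun k => A_ k i j) @ \oo --> A i j) -> A_ @ \oo --> A.
Proof.
move=> H; apply/cvg_ballP => e e0.
have : \forall k \near \oo, forall i j, ball (A i j) e (A_ k i j).
  by apply: filter_forall => i; apply: filter_forall => j; exact: (cvg_ball (H i j)).
by apply: filterS => k Hk; split.
Qed.

Section admissible_sets.
Context (R : realType) (Omega GD GN : set 'rV[R]_3).
Context (Phi : 'M[R]_3 -> R) (gamma : R) (F f : 'rV[R]_3 -> 'rV[R]_3).
Hypothesis hPhi_cont : {within sym3, continuous Phi}.
Hypothesis hPhi_conv : convex_function sym3 Phi.
Local Notation stress := ('rV[R]_3 -> 'M[R]_3).
Local Notation S := (stresses Omega).
Local Notation sdot := (sdot Omega).
Local Notation plastic := (plastic Omega Phi gamma).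
Local Notation Lambda := (Lambda Omega GD GN F f).

Lemma plastic_stresses : plastic `<=` S.
Proof. by move=> s []. Qed.

Lemma lc_segmentE a (s t : stress) x :
  lc a (lc (-1) s t) s x = a *: t x + (1 - a) *: s x.
Proof. by apply/matrixP => i j; rewrite !mxE; ring. Qed.

Lemma plastic_segment : segment_closed plastic.
Proof.
move=> a s t /andP[a0 a1] [Ss Ps] [St Pt]; split.
  by apply: stresses_lin => //; exact: stresses_lin.
move: Ps Pt; apply: filterS2 => x Ps Pt Ox.
have sym u : S u -> u x \in (sym3 : set (convex_lmodType 'M[R]_3)).
  by move=> [_ su]; apply/mem_set/su.
have := hPhi_conv (Itv01 a0 a1) (sym _ St) (sym _ Ss).
rewrite lc_segmentE => /le_trans; apply.
rewrite convRE /= /unstable.onem.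
have := Ps Ox; have := Pt Ox => h1 h2.
have h3 : a * Phi (t x) <= a * gamma by rewrite ler_wpM2l.
have h4 : (1 - a) * Phi (s x) <= (1 - a) * gamma by rewrite ler_wpM2l// subr_ge0.
by lra.
Qed.

Lemma plastic_closed : fast_closed Omega plastic.
Proof.
move=> s g c Ps Sg sg _; split => //.
(* The countably many exceptional null sets are merged into one. *)
have : {ae lebesgue3, forall x, forall n, Omega x -> Phi (s n x) <= gamma}.
  by apply: ae_foralln => n; case: (Ps n).
move: sg; apply: filterS2 => x sg Phis Ox.
have sgx : s ^~ x @ \oo --> g x by apply: cvg_mx_entries => i j; exact: sg.
have symg : sym3 (g x) by case: Sg => _; apply.
have Phig : (fun n => Phi (s n x)) @ \oo --> Phi (g x).
  (* Continuity is relative to the symmetric matrices, where all the terms and the limit lie. *)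
  move=> A /((subspace_continuousP _ _).1 hPhi_cont _ symg) HA.
  have Hn : \forall n \near \oo, sym3 (s n x) -> A (Phi (s n x)) := sgx _ HA.
  apply: (filterS _ Hn) => n {}Hn; apply: Hn.
  by have [[_ ss] _] := Ps n; exact: (ss x Ox).
rewrite -(cvg_lim (@Rhausdorff R) Phig); apply: limr_le.
  by apply/cvg_ex; exists (Phi (g x)).
by apply: nearW => n; exact: Phis.
Qed.

Lemma sym_grad_Vspace v : Vspace Omega GD v -> S (sym_grad v).
Proof. by move=> [Hv _]; exact: sym_grad_stresses. Qed.
Hint Resolve sym_grad_Vspace : core.

Lemma Lambda_segment z : segment_closed (Lambda z).
Proof.
move=> a s t _ [Ss Ls] [St Lt].
have Sd : S (lc (-1) s t) by exact: stresses_lin.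
split; first exact: stresses_lin.
move=> v Vv; have Sv := sym_grad_Vspace Vv.
by rewrite !sdot_linl// Ls// Lt//; ring.
Qed.

(** As s_n satisfies the equation, the residual of [g] is the pairing of g - s_n with the strain;
    Young's inequality with weight 2^(-n) makes it vanish. *)
Lemma Lambda_closed z : fast_closed Omega (Lambda z).
Proof.
move=> s g c Ls Sg _ sg; split => // v Vv; have Sv := sym_grad_Vspace Vv.
set e := sym_grad v in Sv *.
have c0 : 0 <= c.
  by have := sg 0; rewrite expr0 mulr1; apply: le_trans; exact: l2dot_ge0.
have bnd n : `|sdot g e - z * load Omega GN F f v| <=
    0 + (c + sdot e e) * 2^-1 ^+ n.
  have [Ssn Lsn] := Ls n.
  pose d := lc (-1) (s n) g.
  have Sd : S d by exact: stresses_lin.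
  have -> : sdot g e - z * load Omega GN F f v = sdot d e.
    by rewrite /d sdot_linl// Lsn//; ring.
  pose h : R := 2^-1 ^+ n.
  have h0 : 0 < h by rewrite exprn_gt0.
  have h1 : h <= 1 by rewrite exprn_ile1//; lra.
  have h8 : 8^-1 ^+ n = h ^+ 3.
    by rewrite -exprM mulnC exprM; congr (_ ^+ _); rewrite !exprS expr0; lra.
  have := sdot_young h0 Sd Sv; have := sg n; rewrite -/d {}h8 -/h.
  clearbody h => dn young.
  have hd : h^-1 * sdot d d <= c * h.
    rewrite ler_pdivrMl// (le_trans dn)// (_ : h * (c * h) = c * h ^+ 2); last by ring.
    by rewrite ler_wpM2l// exprS ler_piMl// sqr_ge0.
  have he : 0 <= h * sdot e e by rewrite mulr_ge0 ?l2dot_ge0// ltW.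
  have ch : 0 <= c * h by rewrite mulr_ge0// ltW.
  lra.
by apply/eqP; rewrite -subr_eq0 -normr_le0; exact: le_exp2N bnd.
Qed.

End admissible_sets.

(** * The dual potential *)

Section dual_potential.
Context (R : realType) (Omega : set 'rV[R]_3) (C : {linear 'M[R]_3 -> 'M[R]_3}).
Context (Phi : 'M[R]_3 -> R) (gamma : R).
Hypothesis hC : elasticity C.
Hypothesis hPhi_cont : {within sym3, continuous Phi}.
Hypothesis hPhi_conv : convex_function sym3 Phi.
Hypothesis hPhi0 : Phi 0 = 0.
Hypothesis hgamma : 0 < gamma.
Local Notation stress := ('rV[R]_3 -> 'M[R]_3).
Local Notation S := (stresses Omega).
Local Notation sdot := (sdot Omega).
Local Notation qform := (qform Omega C).
Local Notation plastic := (plastic Omega Phi gamma).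
Local Notation Sigma := (Sigma Omega C Phi gamma).
Local Notation Psi := (Psi Omega C Phi gamma).
Implicit Types (e s t : stress).

Lemma plastic0 : plastic (fun=> 0).
Proof.
split; first exact: stresses0.
by apply: aeW => x _; rewrite hPhi0 ltW.
Qed.

Let PS : plastic `<=` S.
Proof. exact: plastic_stresses. Qed.

(** [proj] chooses among the minimizers, so the projection theorem must supply one; minimality is
    then restated without the square root in [cnorm]. *)
Lemma Sigma_projection e : S e -> plastic (Sigma e) /\ forall t, plastic t ->
  qform (lc (-1) (Sigma e) (C \o e)) (lc (-1) (Sigma e) (C \o e)) <=
  qform (lc (-1) t (C \o e)) (lc (-1) t (C \o e)).
Proof.
move=> Se; have SCe := stresses_C hC Se.
have cn t : plastic t -> cnorm Omega C (fun x => (C \o e) x - t x) =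
    Num.sqrt (qform (lc (-1) t (C \o e)) (lc (-1) t (C \o e))).
  by move=> Pt; rewrite subE.
have q0 t : plastic t -> 0 <= qform (lc (-1) t (C \o e)) (lc (-1) t (C \o e)).
  by move=> Pt; apply: qform_ge0 => //; apply: stresses_lin => //; exact: PS.
have [p Pp pmin] := exists_projection hC PS (ex_intro _ _ plastic0)
  (plastic_segment hPhi_conv) (plastic_closed hPhi_cont) SCe.
have [PSig Smin] : plastic (Sigma e) /\ forall t, plastic t ->
    cnorm Omega C (fun x => (C \o e) x - Sigma e x) <=
    cnorm Omega C (fun x => (C \o e) x - t x).
  have exP : exists p, [set p | plastic p /\ forall t, plastic t ->
      cnorm Omega C (fun x => (C \o e) x - p x) <=
      cnorm Omega C (fun x => (C \o e) x - t x)] p.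
    exists p; split => // t Pt; rewrite (cn p)// (cn t)// ler_wsqrtr//.
    exact: pmin.
  exact: (@xgetPex _ (fun=> 0) _ exP).
split => // t Pt; rewrite -ler_sqrt ?q0// -(cn _ PSig) -(cn t)//.
exact: Smin.
Qed.

(* Variational inequality of the projection, in the form of strong concavity of
   the functional maximized in [Psi]. *)
Lemma Sigma_strong_concave e t : S e -> plastic t ->
  sdot t e - 2^-1 * qform t t <=
  sdot (Sigma e) e - 2^-1 * qform (Sigma e) (Sigma e) -
  2^-1 * qform (lc (-1) (Sigma e) t) (lc (-1) (Sigma e) t).
Proof.
move=> Se Pt; have [Ps smin] := Sigma_projection Se.
set s := Sigma e in Ps smin *.
have Ss := PS Ps; have St := PS Pt; have SCe := stresses_C hC Se.
pose d := lc (-1) s t; pose r := lc (-1) s (C \o e).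
have Sd : S d by exact: stresses_lin.
have Sr : S r by exact: stresses_lin.
(* First-order condition: comparing s with s + h d for h = 2^(-n) gives 2 h q(d, r) <= h^2 q(d,
   d). *)
have vi : qform d r <= 0.
  apply: (@le_exp2N _ _ _ (2^-1 * qform d d)) => n; rewrite add0r.
  set h : R := 2^-1 ^+ n.
  have h0 : 0 < h by rewrite exprn_gt0.
  have h1 : h <= 1 by rewrite exprn_ile1//; lra.
  have := smin _ (plastic_segment hPhi_conv (a := h) _ Ps Pt).
  rewrite h1 ltW//= => /(_ isT).
  have -> : lc (-1) (lc h (lc (-1) s t) s) (C \o e) = lc (- h) d r.
    by apply/funext => x; apply/matrixP => i j; rewrite /lc !mxE; ring.
  rewrite -/r (qform_lc hC (- h) Sd Sr) sqrrN => H.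
  have : h * (2 * qform d r) <= h * (h * qform d d) by lra.
  by rewrite ler_pM2l//; lra.
move: vi; rewrite /d /r.
rewrite (qform_lc hC (-1) Ss St) !(qform_linl hC)// !(qform_linr hC)//.
rewrite (qformC hC Ss SCe) (qformC hC St SCe) (qformC hC St Ss) !(qform_C hC)//.
by rewrite !(sdotC _ e); lra.
Qed.

Lemma Sigma_optimal e t : S e -> plastic t ->
  sdot t e - 2^-1 * qform t t <=
  sdot (Sigma e) e - 2^-1 * qform (Sigma e) (Sigma e).
Proof.
move=> Se Pt; apply: le_trans (Sigma_strong_concave Se Pt) _.
have [Ps _] := Sigma_projection Se.
rewrite gerBl mulr_ge0// qform_ge0//.
by apply: stresses_lin; exact: PS.
Qed.

Lemma PsiE e : S e ->
  Psi e = sdot (Sigma e) e - 2^-1 * qform (Sigma e) (Sigma e).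
Proof.
move=> Se; have [Ps _] := Sigma_projection Se.
set v := RHS; set A := [set sdot t e - 2^-1 * cnorm Omega C t ^+ 2 | t in plastic].
have Av : A v by exists (Sigma e) => //; rewrite cnorm_sqr//; exact: PS.
have ubA : ubound A v.
  by move=> _ [t Pt <-]; rewrite cnorm_sqr//; [exact: Sigma_optimal|exact: PS].
apply/eqP; rewrite eq_le; apply/andP; split.
  by apply: ge_sup => //; exists v.
by apply: ub_le_sup => //; exists v.
Qed.

Lemma Psi_ge e t : S e -> plastic t -> sdot t e - 2^-1 * qform t t <= Psi e.
Proof. by move=> Se Pt; rewrite PsiE//; exact: Sigma_optimal. Qed.

(* One-sided quadratic expansion: [Psi] has derivative [sdot (Sigma e)] at [e]. *)
Lemma Psi_le_quadratic a e h : S e -> S h ->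
  Psi (lc a h e) <= Psi e + a * sdot (Sigma e) h + 2^-1 * a ^+ 2 * sdot (C \o h) h.
Proof.
move=> Se Sh; have Seh : S (lc a h e) by exact: stresses_lin.
rewrite (PsiE Seh) (PsiE Se); have [Pt _] := Sigma_projection Seh.
have [Ps _] := Sigma_projection Se.
move: (Sigma_strong_concave Se Pt).
move: (Sigma (lc a h e)) (Sigma e) Pt Ps => t s Pt Ps.
have St := PS Pt; have Ss := PS Ps; have SCh := stresses_C hC Sh.
have Sd : S (lc (-1) s t) by exact: stresses_lin.
(* Completing the square: q(t - s - a C h) >= 0 absorbs the term a <t - s, h> into the concavity
   remainder, at the cost of a^2 <C h, h> / 2. *)
have := qform_ge0 hC (stresses_lin (- a) SCh Sd).
rewrite (qform_lc hC (- a) SCh Sd) (sdot_linr _ Sh Se St).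
rewrite (qform_C hC Sh SCh) (qform_C hC Sh Sd) (sdot_linr _ Ss St Sh).
rewrite (sdotC _ h (C \o h)) (sdotC _ h s) (sdotC _ h t) sqrrN; lra.
Qed.

(** The quadratic upper bound gives 0 <= a k + a^2 b / 2 for every a; both signs of a small a force
    k = 0. *)
Lemma Sigma_critical e h : S e -> S h ->
  (forall a, Psi e <= Psi (lc a h e)) -> sdot (Sigma e) h = 0.
Proof.
move=> Se Sh emin; set k := sdot _ _; set b := sdot (C \o h) h.
have b0 : 0 <= b.
  have SCh := stresses_C hC Sh.
  by have := qform_ge0 hC SCh; rewrite (qform_C hC Sh SCh) sdotC.
have H a : 0 <= a * k + 2^-1 * a ^+ 2 * b.
  by have := le_trans (emin a) (Psi_le_quadratic a Se Sh); rewrite -/k -/b; lra.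
have : `|k| <= 0.
  apply: (@le_exp2N _ _ _ (2^-1 * b)) => n; rewrite add0r.
  set r : R := 2^-1 ^+ n.
  have r0 : 0 < r by rewrite exprn_gt0.
  have H1 := H r; have := H (- r); rewrite sqrrN => H2.
  suff : r * `|k| <= r * (2^-1 * b * r) by rewrite ler_pM2l.
  rewrite -[r in leLHS](gtr0_norm r0) -normrM ler_norml.
  by apply/andP; split; lra.
by rewrite normr_le0 => /eqP.
Qed.

End dual_potential.

(** * The Lagrange multiplier rule and the dual problems *)

Section dual_problems.
Context (R : realType) (Omega GD GN : set 'rV[R]_3).
Context (C : {linear 'M[R]_3 -> 'M[R]_3}) (Phi : 'M[R]_3 -> R) (gamma : R).
Context (F f : 'rV[R]_3 -> 'rV[R]_3).
Hypothesis hG : boundary_parts Omega GD GN.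
Hypothesis hC : elasticity C.
Hypothesis hPhi_cont : {within sym3, continuous Phi}.
Hypothesis hPhi_conv : convex_function sym3 Phi.
Hypothesis hPhi0 : Phi 0 = 0.
Hypothesis hgamma : 0 < gamma.
Hypothesis hF : L2 lebesgue3 Omega F.
Hypothesis hf : L2 surf GN f.
Local Notation stress := ('rV[R]_3 -> 'M[R]_3).
Local Notation S := (stresses Omega).
Local Notation sdot := (sdot Omega).
Local Notation qform := (qform Omega C).
Local Notation plastic := (plastic Omega Phi gamma).
Local Notation Sigma := (Sigma Omega C Phi gamma).
Local Notation Psi := (Psi Omega C Phi gamma).
Local Notation Lambda := (Lambda Omega GD GN F f).
Local Notation load := (load Omega GN F f).
Local Notation energy := (energy Omega C).
Local Notation Vspace := (Vspace Omega GD).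
Local Notation solves_dual := (solves_dual Omega GD GN C Phi gamma F f).
Local Notation sigma_of := (sigma_of Omega GD GN C Phi gamma F f).
Local Notation Dset := (Dset Omega GD GN Phi gamma F f).
Local Notation omega := (omega Omega GD GN F f).

Lemma energyE (t : stress) : S t -> energy t = 2^-1 * qform t t.
Proof. by move=> St; rewrite /Defs.energy cnorm_sqr. Qed.

(** The solution is the projection of the zero stress onto the closed convex set of admissible
    stresses. *)
Lemma sigma_ofP z : Dset z -> solves_dual z (sigma_of z).
Proof.
move=> [_ LP0]; have LPS : Lambda z `&` plastic `<=` S by move=> t [[]].
have seg : segment_closed (Lambda z `&` plastic).
  move=> a s t a01 [Ls Ps] [Lt Pt]; split; first exact: Lambda_segment.
  exact: plastic_segment.
have cls : fast_closed Omega (Lambda z `&` plastic).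
  move=> s g c LPs Sg sg sgc; split.
    by apply: Lambda_closed Sg sg sgc => n; case: (LPs n).
  by apply: plastic_closed Sg sg sgc => // n; case: (LPs n).
have [p LPp pmin] := exists_projection hC LPS LP0 seg cls (stresses0 Omega).
apply: (@xgetPex _ (fun=> 0) [set s | solves_dual z s]); exists p; split => // t LPt.
have := pmin _ LPt; have Sp := LPS _ LPp; have St := LPS _ LPt.
have q0 (s : stress) : S s -> qform (lc (-1) s (fun=> 0)) (lc (-1) s (fun=> 0)) = qform s s.
  (* Writing -s as -2s + s lets [qform_lc] apply: 4 - 4 + 1 = 1. *)
  move=> Ss; have -> : lc (-1) s (fun=> 0) = lc (-2) s s.
    by apply/funext => x; apply/matrixP => i j; rewrite /lc !mxE; ring.
  by rewrite qform_lc//; ring.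
by rewrite !q0// !energyE// ler_pM2l.
Qed.

Variables (alpha : R) (u : field1 R).
Hypothesis alpha_gt0 : 0 < alpha.
Hypothesis Vu : Vspace u.
Hypothesis load_u : load u = alpha.

(** The load factor is read off by testing with [u], whose load is nonzero. *)
Lemma Lambda_unique z w (t : stress) : Lambda z t -> Lambda w t -> z = w.
Proof.
move=> [_ Lz] [_ Lw]; have := Lz _ Vu; rewrite (Lw _ Vu) load_u.
by move=> /(mulIf (lt0r_neq0 alpha_gt0)).
Qed.

Lemma omegaE z (t : stress) : 0 <= z -> Lambda z t -> omega t = z.
Proof.
move=> z0 Lz; apply: xget_unique => // w [_ Lw].
exact: Lambda_unique Lw Lz.
Qed.

Hypothesis umin : forall v, Vspace v -> load v = alpha ->
  Psi (sym_grad u) <= Psi (sym_grad v).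

Let e := sym_grad u.
Let s := Sigma e.
(** The Lagrange multiplier, identified with [psi alpha] in [psiE]. *)
Let z := alpha^-1 * sdot s e.

Let Se : S e.
Proof. by apply: sym_grad_Vspace Vu. Qed.

Let Ps : plastic s.
Proof. by have [] := Sigma_projection hC hPhi_cont hPhi_conv hPhi0 hgamma Se. Qed.

Let Ss : S s.
Proof. by case: Ps. Qed.

Let az : alpha * z = sdot s e.
Proof. by rewrite /z mulrA divff ?mul1r// gt_eqF. Qed.

(** Optimality of [s] against the zero stress gives <s, e> >= q(s) / 2 >= 0. *)
Lemma multiplier_ge0 : 0 <= z.
Proof.
apply: mulr_ge0; first by rewrite invr_ge0 ltW.
have P0 := plastic0 Omega hPhi0 hgamma.
have := Sigma_optimal hC hPhi_cont hPhi_conv hPhi0 hgamma Se P0.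
have -> : (fun=> 0) = lc (-1) s s.
  by apply/funext => x; rewrite /lc scaleN1r addNr.
rewrite -/s sdot_linl// (qform_lc hC)//.
have := qform_ge0 hC Ss.
lra.
Qed.

(* Lagrange multiplier rule: the derivative of [Psi] at [e] vanishes on
   the kernel of the load, hence is proportional to the load. *)
Lemma Lambda_Sigma : Lambda z s.
Proof.
split => // v Vv; have Sv := sym_grad_Vspace Vv.
(* The multiple of [u] cancels the load of [v], so moving from [u] along [w] keeps the load equal to
   [alpha]. *)
pose w := lin1 (- (load v / alpha)) u v.
have Vw : Vspace w by exact: (Vspace_lin1 hG).
have Lw : load w = 0.
  have [Hv _] := Vv; have [Hu _] := Vu.
  by rewrite /w (load_lin1 hG)// load_u mulNr divfK ?gt_eqF// addNr.
have := @Sigma_critical _ _ _ _ _ hC hPhi_cont hPhi_conv hPhi0 hgamma e (sym_grad w) Se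
  (sym_grad_Vspace Vw) _.
have crit a : Psi e <= Psi (lc a (sym_grad w) e).
  rewrite -[lc _ _ _](sym_grad_lin1 a w u); apply: umin.
    exact: (Vspace_lin1 hG).
  have [Hw _] := Vw; have [Hu _] := Vu.
  by rewrite (load_lin1 hG)// Lw mulr0 add0r.
move=> /(_ crit); rewrite -/s /w sym_grad_lin1.
rewrite -[X in sdot s X = 0]/(lc (- (load v / alpha)) (sym_grad u) (sym_grad v)).
rewrite sdot_linr// => /eqP; rewrite mulNr addrC subr_eq0 => /eqP ->.
by rewrite -/e /z; ring.
Qed.

(** On [Lambda y] the pairing with [e] equals alpha y, so this is the strong concavity of the dual
    functional. The quadratic remainder is kept for the uniqueness part of [psiE]. *)
Lemma Lagrangian_le y (t : stress) : Lambda y t -> plastic t ->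
  energy s - alpha * z <= energy t - alpha * y -
    2^-1 * qform (lc (-1) s t) (lc (-1) s t).
Proof.
move=> Lt Pt; have St : S t by case: Lt.
have := Sigma_strong_concave hC hPhi_cont hPhi_conv hPhi0 hgamma Se Pt.
rewrite -/s -az !energyE// (_ : sdot t e = alpha * y); last first.
  by case: Lt => _ ->//; rewrite load_u mulrC.
lra.
Qed.

Let Lagrangian_min y (t : stress) : Lambda y t -> plastic t ->
  energy s - alpha * z <= energy t - alpha * y.
Proof.
move=> Lt Pt; apply: le_trans (Lagrangian_le Lt Pt) _.
rewrite gerBl mulr_ge0// (qform_ge0 hC)//.
by apply: stresses_lin => //; case: Lt.
Qed.

Lemma Sigma_solves_dual : solves_dual z s.
Proof.
split; first by split; [exact: Lambda_Sigma|].
move=> t [Lt Pt]; have := Lagrangian_min Lt Pt; lra.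
Qed.

Lemma Sigma_solves_dual_alpha :
  solves_dual_alpha Omega GD GN C Phi gamma F f alpha s.
Proof.
split; first by split => //; exists z; [exact: multiplier_ge0|exact: Lambda_Sigma].
move=> t [[y /= y0 Lt] Pt].
rewrite (omegaE multiplier_ge0 Lambda_Sigma) (omegaE y0 Lt).
exact: Lagrangian_min.
Qed.

Lemma multiplier_in_Dset : Dset z.
Proof.
by split; [exact: multiplier_ge0|exists s; split => //; exact: Lambda_Sigma].
Qed.

Let phiE y : Dset y ->
  phi Omega GD GN C Phi gamma F f y = (energy (sigma_of y))%:E.
Proof. by move=> Dy; rewrite /Defs.phi mem_set. Qed.

Let energy_sigma_of : energy (sigma_of z) = energy s.
Proof.
have [LPz zmin] := sigma_ofP multiplier_in_Dset.
have [LPs smin] := Sigma_solves_dual.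
by apply/eqP; rewrite eq_le zmin// smin.
Qed.

Lemma psiE : psi Omega GD GN C Phi gamma F f alpha = z.
Proof.
have Dz := multiplier_in_Dset.
apply: xget_unique.
  split => // y Dy; rewrite !phiE// -!EFinB lee_fin energy_sigma_of.
  by have [[Ly Py] _] := sigma_ofP Dy; exact: Lagrangian_min.
move=> y [Dy ymin]; have := ymin _ Dz.
rewrite !phiE// -!EFinB lee_fin energy_sigma_of.
have [[Ly Py] _] := sigma_ofP Dy.
set t := sigma_of y in Ly Py * => le_ty.
have St : S t by case: Ly.
have Sd : S (lc (-1) s t) by exact: stresses_lin.
(* A second minimizer [y] leaves no room for the remainder, so t - s has norm 0. Its pairing alpha y
   - alpha z with [e] then vanishes, by Young's inequality with weight 2^(-n). *)
have q0 : qform (lc (-1) s t) (lc (-1) s t) <= 0.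
  by have := Lagrangian_le Ly Py; lra.
have [K K0 HK] := sdot_le_qform Omega hC.
have d0 : sdot (lc (-1) s t) (lc (-1) s t) <= 0.
  by apply: (le_trans (HK _ Sd)); rewrite pmulr_rle0.
have : `|sdot (lc (-1) s t) e| <= 0.
  apply: (@le_exp2N _ _ _ (sdot e e)) => n; rewrite add0r.
  have h0 : 0 < 2^-1 ^+ n :> R by rewrite exprn_gt0.
  have := sdot_young h0 Sd Se.
  have : (2^-1 ^+ n)^-1 * sdot (lc (-1) s t) (lc (-1) s t) <= 0.
    by rewrite pmulr_rle0// invr_gt0.
  have : 0 <= 2^-1 ^+ n * sdot e e by apply: mulr_ge0 (ltW h0) (l2dot_ge0 _ _ _).
  lra.
rewrite normr_le0 sdot_linl// -az => /eqP.
case: Ly => _ /(_ _ Vu) ->; rewrite load_u => H.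
by apply: (mulIf (lt0r_neq0 alpha_gt0)); lra.
Qed.

(** Using [s] as a competitor in the supremum defining [Psi] and its equilibrium with the load z L,
    every J_z(v) is at least -q(s) / 2, which is J_z(u). *)
Lemma primal_solution : solves_primal Omega GD GN C Phi gamma F f z u.
Proof.
split => // v Vv; rewrite /Jfun -/e.
have Sv := sym_grad_Vspace Vv.
have := Psi_ge hC hPhi_cont hPhi_conv hPhi0 hgamma Sv Ps.
rewrite (PsiE hC hPhi_cont hPhi_conv hPhi0 hgamma Se) -/s load_u.
have [_ ->//] := Lambda_Sigma.
by rewrite -az; lra.
Qed.

End dual_problems.

(** * Equivalence of the load-controlled and multiplier formulations *)

Unset Implicit Arguments.

Theorem theorem4p1 (R : realType) (Omega GD GN : set 'rV[R]_3)
  (C : {linear 'M[R]_3 -> 'M[R]_3}) (Phi : 'M[R]_3 -> R) (gamma : R)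
  (F f : 'rV[R]_3 -> 'rV[R]_3)
  (hOmega : bounded_lipschitz_domain Omega)
  (hG : boundary_parts Omega GD GN)
  (hC : elasticity C)
  (hPhi_cont : {within sym3, continuous Phi})
  (hPhi_conv : convex_function sym3 Phi)
  (hPhi0 : Phi 0 = 0)
  (hgamma : 0 < gamma)
  (hF : L2 lebesgue3 Omega F)
  (hf : L2 surf GN f)
  (hFf : 0 < l2norm lebesgue3 Omega F + l2norm surf GN f)
  (hlim : (0 < zeta_lim Omega GD GN Phi gamma F f)%E) :
  (forall (alpha : R) (u : field1 R), 0 < alpha ->
    solves_primal_alpha Omega GD GN C Phi gamma F f alpha u ->
    let zeta := psi Omega GD GN C Phi gamma F f alpha in
    let sigma := Sigma Omega C Phi gamma (sym_grad u) in
    [/\ zeta = alpha^-1 * sdot Omega sigma (sym_grad u),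
        solves_primal Omega GD GN C Phi gamma F f zeta u,
        solves_dual_alpha Omega GD GN C Phi gamma F f alpha sigma &
        solves_dual Omega GD GN C Phi gamma F f zeta sigma]) /\
  (forall (zeta : R) (u : field1 R), 0 <= zeta ->
    solves_primal Omega GD GN C Phi gamma F f zeta u ->
    solves_primal_alpha Omega GD GN C Phi gamma F f (load Omega GN F f u) u).
Proof.
split=> [alpha u alpha0 [[Vu Lu] umin] /=|zeta u _ [Vu umin]].
  have {}umin v : Vspace Omega GD v -> load Omega GN F f v = alpha ->
      Psi Omega C Phi gamma (sym_grad u) <= Psi Omega C Phi gamma (sym_grad v).
    by move=> Vv Lv; apply: umin.
  rewrite (psiE hG hC hPhi_cont hPhi_conv hPhi0 hgamma hF hf alpha0 Vu Lu umin).
  split => //.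
  - exact: primal_solution.
  - exact: Sigma_solves_dual_alpha.
  - exact: Sigma_solves_dual.
split; first by split.
(* Among fields with the same load as [u], [Jfun] and the potential differ by a constant. *)
move=> v [Vv Lv]; have := umin v Vv.
by rewrite /Jfun Lv lerD2r.
Qed.
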